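(* Let $L$ and $L_0$ be the perturbed and the free Ornstein-Uhlenbeck operators on $L^2(\mathbb{R}^d)$ defined in the context, and let $\sigma'(L):=\sigma(L)\setminus\sigma(L_0)$. Then, for any $b>0$, the set $$\sigma'(L)\cap\{d+b+i\omega:\ \omega\in\mathbb{R}\}$$ is bounded.
   Context: Let $d\ge2$ and let $V:[0,\infty)\to\mathbb{C}$ satisfy $|V(r)|\le C\langle r\rangle^{-2}$, $|V'(r)|\le C\langle r\rangle^{-3}$ for all $r\ge0$ and some constant $C>0$, where $\langle r\rangle:=\sqrt{1+r^2}$. Put $\mathcal{L}_V u(x):=\Delta u(x)-2x\cdot\nabla u(x)+V(|x|)u(x)$ and $\mathcal{D}(\tilde L):=\{u\in H^2(\mathbb{R}^d)\cap C^\infty(\mathbb{R}^d):\mathcal{L}_V u\in L^2(\mathbb{R}^d)\}$. The operator $L$ is the closure in $L^2(\mathbb{R}^d)$ of $\tilde L u:=\mathcal{L}_V u$, $u\in\mathcal{D}(\tilde L)$, and $L_0$ is the closure of $\tilde L_0u:=\tilde L u-Vu=\Delta u-2x\cdot\nabla u$, $u\in\mathcal{D}(\tilde L)$ (both operators are closable). $\sigma(\cdot)$ denotes the spectrum. *)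

(* Defs.v *)
From HB Require Import structures.
From mathcomp Require Import all_boot all_order all_algebra.
From mathcomp Require Import complex.
From mathcomp Require Import all_classical all_reals all_analysis.

Set Implicit Arguments.
Unset Strict Implicit.
Unset Printing Implicit Defensive.
Import Order.TTheory GRing.Theory Num.Theory.
Import numFieldNormedType.Exports.

Local Open Scope classical_set_scope.
Local Open Scope ring_scope.
Local Open Scope complex_scope.

Definition measure_row_display : measure_display -> measure_display.
Proof. exact. Qed.

Section row_measurable.
Context (R : realType) (n : nat).

Let coord (i : 'I_n) (x : 'rV[R]_n) : measurableTypeR R := x ord0 i.

Let row_set0 : g_sigma_preimage coord set0.
Proof. exact: sigma_algebra0. Qed.

Let row_setC A : g_sigma_preimage coord A -> g_sigma_preimage coord (~` A).
Proof. exact: sigma_algebraC. Qed.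

Let row_bigcup (F : (set 'rV[R]_n)^nat) :
  (forall i, g_sigma_preimage coord (F i)) ->
  g_sigma_preimage coord (\bigcup_i (F i)).
Proof. exact: sigma_algebra_bigcup. Qed.

(* The product sigma-algebra, i.e., the Borel sets of [R^n]. *)
HB.instance Definition _ :=
  @isMeasurable.Build (measure_row_display (R.-ocitv.-measurable).-sigma) 'rV[R]_n
    (g_sigma_preimage coord) row_set0 row_setC row_bigcup.

Lemma measurable_row_coord (i : 'I_n) :
  measurable_fun [set: 'rV[R]_n] (fun x => x ord0 i : measurableTypeR R).
Proof.
move=> _ Y mY; rewrite setTI; apply: sub_sigma_algebra => /=.
rewrite -bigcup_seq/=; exists i => /=; first by rewrite mem_index_enum.
by exists Y => //; rewrite setTI.
Qed.

Lemma measurable_fun_rowP d (T : measurableType d) (f : T -> 'rV[R]_n) :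
  (forall i, measurable_fun [set: T] (fun t => f t ord0 i : measurableTypeR R)) ->
  measurable_fun [set: T] f.
Proof.
move=> mf _ A mA; rewrite setTI.
pose G := [set B : set 'rV[R]_n | measurable (f @^-1` B)].
suff: g_sigma_preimage coord `<=` G by apply.
apply: smallest_sub.
  split.
  - by rewrite /G/= preimage_set0.
  - by move=> B; rewrite /G/= setTD preimage_setC; exact: measurableC.
  - by move=> F mF; rewrite /G/= preimage_bigcup; exact: bigcupT_measurable.
rewrite -bigcup_seq/= => B/= [i _ [C mC <-]].
by rewrite /G/= setTI; have := mf i measurableT C mC; rewrite setTI.
Qed.

End row_measurable.

Section row_cons.
Context (R : realType) (n : nat).

Definition row_cons (p : measurableTypeR R * 'rV[R]_n) : 'rV[R]_n.+1 :=
  row_mx (p.1)%:M p.2 : 'rV[R]_(1 + n).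

Definition row_uncons (x : 'rV[R]_n.+1) : measurableTypeR R * 'rV[R]_n :=
  (x ord0 ord0, rsubmx (x : 'rV[R]_(1 + n))).

Lemma row_consK : cancel row_cons row_uncons.
Proof.
case=> a v; rewrite /row_uncons/row_cons/= row_mxKr; congr pair.
transitivity ((row_mx a%:M v : 'rV[R]_(1 + n)) ord0 (lshift n ord0)).
  by congr (fun_of_matrix _ _ _); exact: val_inj.
by rewrite row_mxEl mxE eqxx mulr1n.
Qed.

Lemma row_cons0 p : row_cons p ord0 ord0 = p.1.
Proof. exact: (congr1 fst (row_consK p)). Qed.

Lemma row_consS p j : row_cons p ord0 (lift ord0 j) = p.2 ord0 j.
Proof.
transitivity ((row_cons p : 'rV[R]_(1 + n)) ord0 (rshift 1 j)).
  by congr (fun_of_matrix _ _ _); exact: val_inj.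
exact: row_mxEr.
Qed.

Lemma measurable_row_cons : measurable_fun setT row_cons.
Proof.
apply: measurable_fun_rowP => i.
rewrite -(splitK (i : 'I_(1 + n))); case: (fintype.split _) => j /=.
  rewrite (_ : (fun _ => _) = fst); first exact: measurable_fst.
  by apply/funext => p; rewrite [LHS]row_mxEl mxE (ord1 j) eqxx mulr1n.
rewrite (_ : (fun _ => _) =
    (fun x : 'rV[R]_n => x ord0 j : measurableTypeR R) \o snd).
  by apply: measurableT_comp; [exact: measurable_row_coord|exact: measurable_snd].
by apply/funext => p; rewrite [LHS]row_mxEr.
Qed.

Lemma measurable_row_uncons : measurable_fun setT row_uncons.
Proof.
apply: measurable_fun_pair => /=; first exact: measurable_row_coord.
apply: measurable_fun_rowP => j; under eq_fun do rewrite mxE.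
exact: measurable_row_coord.
Qed.

Lemma row_unconsK : cancel row_uncons row_cons.
Proof.
move=> x; apply/rowP => i; rewrite /row_cons/row_uncons/=.
rewrite -(splitK (i : 'I_(1 + n))); case: (fintype.split _) => j /=.
  rewrite [LHS]row_mxEl mxE (ord1 j) eqxx mulr1n; congr (x _ _).
  exact: val_inj.
by rewrite [LHS]row_mxEr mxE.
Qed.

Context (mu : {sigma_finite_measure set 'rV[R]_n -> \bar R}).

Definition row_push := pushforward (@lebesgue_measure R \x mu)%E row_cons.

Let row_push0 : row_push set0 = 0%E.
Proof. rewrite /row_push; have mf := measurable_row_cons; exact: measure0. Qed.

Let row_push_ge0 A : (0 <= row_push A)%E.
Proof. rewrite /row_push; have mf := measurable_row_cons; exact: measure_ge0. Qed.

Let row_push_sigma_additive : semi_sigma_additive row_push.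
Proof.
rewrite /row_push; have mf := measurable_row_cons; exact: measure_semi_sigma_additive.
Qed.

HB.instance Definition _ := isMeasure.Build _ _ _ row_push
  row_push0 row_push_ge0 row_push_sigma_additive.

Let row_push_sigma_finite : sigma_finite setT row_push.
Proof.
have /sigma_finiteP[F [TF ndF Foo]] := sigma_finiteT (@lebesgue_measure R).
have /sigma_finiteP[G [TG ndG Goo]] := sigma_finiteT mu.
exists (fun k => row_uncons @^-1` (F k `*` G k)).
  rewrite -preimage_bigcup (_ : \bigcup_k (F k `*` G k) = setT) ?preimage_setT//.
  apply/seteqP; split => // -[x y] _.
  have [k _ Fk] : (\bigcup_k F k) x by rewrite -TF.
  have [l _ Gl] : (\bigcup_k G k) y by rewrite -TG.
  exists (maxn k l) => //; split => /=.
    by move: x Fk; exact/subsetPset/ndF/leq_maxl.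
  by move: y Gl; exact/subsetPset/ndG/leq_maxr.
move=> k; have [mF Fk] := Foo k; have [mG Gk] := Goo k; split.
  by rewrite -[X in measurable X]setTI; apply: measurable_row_uncons => //;
    exact: measurableX.
rewrite /row_push/pushforward -comp_preimage.
rewrite (_ : _ \o _ = id) ?preimage_id; last first.
  by apply/funext => p; exact: row_consK.
by rewrite product_measure1E// lte_mul_pinfty// ge0_fin_numE.
Qed.

HB.instance Definition _ := Measure_isSigmaFinite.Build _ _ _ row_push
  row_push_sigma_finite.

End row_cons.

(* [row_cons (a, v)] has first coordinate [a] and remaining coordinates [v],
   so this is the [n]-fold product of the Lebesgue measure on [R]. *)
Fixpoint lebesgue_rV (R : realType) (n : nat) :
    {sigma_finite_measure set 'rV[R]_n -> \bar R} :=
  match n with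
  | 0 => [the {sigma_finite_measure set 'rV[R]_0 -> \bar R} of
           \d_(0 : 'rV[R]_0)]
  | m.+1 => [the {sigma_finite_measure set 'rV[R]_m.+1 -> \bar R} of
             row_push (lebesgue_rV R m)]
  end.

Lemma lebesgue_rV_box (R : realType) (n : nat)
    (A : 'I_n -> set (measurableTypeR R)) :
  (forall i, measurable (A i)) ->
  lebesgue_rV R n [set x | forall i, A i (x ord0 i)] =
  (\prod_(i < n) lebesgue_measure (A i))%E.
Proof.
elim: n A => [|n IH] A mA /=.
  rewrite big_ord0 diracE mem_set//=; first by move=> [].
rewrite /row_push/pushforward.
have -> : row_cons (n:=n) @^-1` [set x | forall i, A i (x ord0 i)] =
    A ord0 `*` [set v : 'rV[R]_n | forall j, A (lift ord0 j) (v ord0 j)].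
  apply/seteqP; split => [p /= Ap|p /= [A0 A1] i].
    split; first by have /= := Ap ord0; rewrite (row_cons0 p).
    by move=> j; have := Ap (lift ord0 j); rewrite row_consS.
  case: (unliftP ord0 i) => [j ->|->]; last by rewrite row_cons0.
  by rewrite row_consS; exact: A1.
rewrite product_measure1E//.
  by rewrite big_ord_recl -(IH (fun j => A (lift ord0 j))).

rewrite (_ : [set v | _] = \bigcap_(j in setT)
  (fun v : 'rV[R]_n => v ord0 j : measurableTypeR R) @^-1` A (lift ord0 j)).
  apply: fin_bigcap_measurable => [|j _]; first exact: finite_finset.
  by rewrite -[X in measurable X]setTI; exact: measurable_row_coord.
by apply/seteqP; split => [v Av j _|v Av j]; [exact: Av|exact: (Av j)].
Qed.

Section complex_functions.
Context (R : realType) (d : nat).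
Local Notation E := 'rV[R]_d.
Local Notation mu := (lebesgue_rV R d).
Local Notation normc := (@ComplexField.Normc.normc R).
Implicit Types (u v f g phi : E -> R[i]) (x : E).

(* The library norm [`|x|] on ['rV[R]_d] is the sup norm. *)
Definition enorm x : R := Num.sqrt (\sum_(i < d) x ord0 i ^+ 2).

Definition cintegral f : R[i] :=
  (\int[mu]_x complex.Re (f x))%R +i* (\int[mu]_x complex.Im (f x))%R.

Definition cmeasurable f :=
  measurable_fun [set: E] (fun x => complex.Re (f x)) /\
  measurable_fun [set: E] (fun x => complex.Im (f x)).

Definition L2norm f : \bar R := Lnorm mu 2%:E (fun x => (normc (f x))%:E).

(* The elements of the Hilbert space L^2(R^d) are
   their classes modulo [ae_equal]; below we work with representatives. *)
Definition L2 : set (E -> R[i]) :=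
  [set f | cmeasurable f /\ (L2norm f < +oo)%E].

Definition ae_equal f g := \forall x \ae mu, f x = g x.

Definition partial (i : 'I_d) u : E -> R[i] := fun x =>
  ('D_(delta_mx ord0 i) (fun y => complex.Re (u y) : R^o) x) +i*
  ('D_(delta_mx ord0 i) (fun y => complex.Im (u y) : R^o) x).

(* [partials [:: i1; ...; ik] u] is the iterated derivative
   d_{i1} ... d_{ik} u. *)
Definition partials (s : seq 'I_d) u : E -> R[i] := foldr partial u s.

Definition smooth u := forall s : seq 'I_d,
  [/\ continuous (fun x => complex.Re (partials s u x) : R^o),
      continuous (fun x => complex.Im (partials s u x) : R^o) &
      forall (i : 'I_d) x,
        derivable (fun y => complex.Re (partials s u y) : R^o) x (delta_mx ord0 i)
        /\
        derivable (fun y => complex.Im (partials s u y) : R^o) x (delta_mx ord0 i)].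

Definition test_function phi :=
  smooth phi /\ compact (closure [set x | phi x != 0]).

Definition weak_partials (s : seq 'I_d) u g :=
  forall phi, test_function phi ->
    cintegral (fun x => u x * partials s phi x) =
    (-1) ^+ size s * cintegral (fun x => g x * phi x).

Definition H2 : set (E -> R[i]) :=
  [set u | L2 u /\ forall s : seq 'I_d, (size s <= 2)%N ->
             exists2 g, L2 g & weak_partials s u g].

(* An unbounded operator is given by its graph, a set of pairs [(u, A u)]. *)
Definition operator := set ((E -> R[i]) * (E -> R[i])).

(* The graph of the closure of a closable operator is the closure of its graph
   in L^2 x L^2; it contains all the representatives of a class. *)
Definition op_closure (A : operator) : operator :=
  [set p | [/\ L2 p.1, L2 p.2 &
    exists u v : nat -> E -> R[i],
      [/\ forall n, A (u n, v n),
          L2norm (fun x => u n x - p.1 x) @[n --> \oo] --> 0%E &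
          L2norm (fun x => v n x - p.2 x) @[n --> \oo] --> 0%E]]].

(* [(z - A) u] for [p = (u, A u)]. *)
Definition shifted (z : R[i]) (p : (E -> R[i]) * (E -> R[i])) : E -> R[i] :=
  fun x => z * p.1 x - p.2 x.

Definition resolvent_set (A : operator) : set R[i] :=
  [set z |
    [/\ forall p q, A p -> A q ->
          ae_equal (shifted z p) (shifted z q) -> ae_equal p.1 q.1,
        forall h, L2 h -> exists2 p, A p & ae_equal (shifted z p) h &
        exists M : R, forall p, A p ->
          (L2norm p.1 <= M%:E * L2norm (shifted z p))%E]].

Definition spectrum (A : operator) : set R[i] := ~` resolvent_set A.

Definition laplacian u : E -> R[i] := fun x =>
  \sum_(i < d) partials [:: i; i] u x.

Definition drift u : E -> R[i] := fun x =>
  \sum_(i < d) (x ord0 i)%:C * partial i u x.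

Definition ou_expr u : E -> R[i] := fun x => laplacian u x - 2 * drift u x.

Section potential.
Variable V : R -> R[i].

Definition ouV_expr u : E -> R[i] := fun x => ou_expr u x + V (enorm x) * u x.

Definition ou_domain : set (E -> R[i]) :=
  [set u | [/\ H2 u, smooth u & L2 (ouV_expr u)]].

Definition pre_L : operator := [set p | ou_domain p.1 /\ p.2 = ouV_expr p.1].
Definition pre_L0 : operator := [set p | ou_domain p.1 /\ p.2 = ou_expr p.1].

Definition OU_L : operator := op_closure pre_L.
Definition OU_L0 : operator := op_closure pre_L0.

Definition sigma' : set R[i] := spectrum OU_L `\` spectrum OU_L0.

End potential.

End complex_functions.

Section halfline.
Context (R : realType).
Implicit Types (V : R -> R[i]) (r : R).

Definition japanese r : R := Num.sqrt (1 + r ^+ 2).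

(* [l] is the derivative at [r] of the restriction of [V] to [0, +oo[; it is
   one-sided when [r = 0], and values of [V] at negative reals are irrelevant
   when [0 <= r]. *)
Definition halfline_derivative V r (l : R[i]) :=
  (complex.Re (V s) - complex.Re (V r)) / (s - r)
    @[s --> within [set s | 0 <= s] r^'] --> complex.Re l /\
  (complex.Im (V s) - complex.Im (V r)) / (s - r)
    @[s --> within [set s | 0 <= s] r^'] --> complex.Im l.

End halfline.

(* Main.v *)
(* With [f = (z - L_0) u], [z = d + b + i omega], pair [f] with [u] itself (real
   part) and with [u / (1 + |x|^2)] (imaginary part).  The weight makes the
   unbounded drift [2 x . grad] bounded, and the sum of the two identities gives
   [int (1 + |omega| / (1 + |x|^2)) |u|^2 <= K int |f|^2], [K] depending only on
   [b].  As [|V(|x|)|^2 <= C^2 / (1 + |x|^2)], multiplication by [V] composed with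
   the resolvent of [L_0] has norm at most [C sqrt (K / |omega|)], so for large
   [|omega|] a point of the resolvent set of [L_0] is in that of [L] by a Neumann
   series. *)

(* The line [Re z = d + b] enters through [2 Re (conj(u) x . grad u) = div (x |u|^2) - d |u|^2]: the
   divergence of the drift cancels [d] and leaves [b |u|^2], which is coercive. The obstacle is that
   [u] in [H^2] gives no decay of [x . grad u], so the boundary terms at infinity cannot be
   discarded. The pairing is therefore done with a compactly supported weight [m^2]; it is chosen so
   that its commutator with the drift has a favourable sign and its other errors are [O(1/N)] times
   the squared norm of [u]. Only the divergence theorem for compactly supported fields is then
   required, and the cutoff disappears as [N] grows. An energy inequality gives no surjectivity of
   [z - L_0]. That comes from [z] lying outside [sigma(L_0)], which explains why the statement is
   about [sigma'(L)]; the inequality makes the inverse quantitatively small after multiplication by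
   [V]. It is proved for smooth functions and extended to closures by approximation in the graph
   norm. *)
Require Import Defs.
From mathcomp Require Import all_boot all_order all_algebra.
From mathcomp Require Import complex.
From mathcomp Require Import all_classical all_reals all_analysis.
From mathcomp Require Import measurable_realfun ring lra.

Import Order.TTheory GRing.Theory Num.Theory.
Import numFieldNormedType.Exports.

Local Open Scope classical_set_scope.
Local Open Scope ring_scope.
Local Open Scope complex_scope.
Set Implicit Arguments.
Unset Strict Implicit.
Unset Printing Implicit Defensive.

(** * Integration by parts on R^d *)

Section rV_measure.
Context {R : realType}.

(** The sigma-algebra is the product one, whereas [open] refers to the sup norm. The two meet
    because an open set is the union of the rational boxes [B p] that it contains, and there are
    countably many of them. *)
Lemma open_measurable_rV n (U : set 'rV[R]_n) : open U -> measurable U.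
Proof.
move=> oU.
pose B (p : 'rV[rat]_n * nat) : set 'rV[R]_n :=
  [set x | forall i, ball (ratr (p.1 ord0 i) : R) p.2.+1%:R^-1 (x ord0 i)].
have mB p : measurable (B p).
  rewrite (_ : B p = \bigcap_(i in setT) (fun v : 'rV[R]_n =>
      v ord0 i : measurableTypeR R) @^-1` ball (ratr (p.1 ord0 i) : R) p.2.+1%:R^-1).
    apply: fin_bigcap_measurable => [|j _]; first exact: finite_finset.
    rewrite -[X in measurable X]setTI; apply: measurable_row_coord => //.
    exact: measurable_ball.
  by apply/seteqP; split => [v Av j _|v Av j]; [exact: Av|exact: (Av j)].
rewrite (_ : U = \bigcup_(p in [set p | B p `<=` U]) B p).
  rewrite bigcup_mkcond; apply: countable_bigcupT_measurable => // p.
  by case: ifPn.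
apply/seteqP; split => [x Ux|x [p /= BU]]; last exact: BU.
have [e /= e0 xeU] : nbhs_ball x U.
  by apply/nbhs_ballP; exact: open_nbhs_nbhs.
(* Since [2 / (k + 1) < e], a box of radius [1 / (k + 1)] whose rational centre is within
   [1 / (k + 1)] of [x] contains [x] and stays in the [e]-ball about [x]. *)
pose k := Num.truncn (2 / e).
have ke : 2 * k.+1%:R^-1 < e.
  rewrite ltr_pdivrMr// mulrC -ltr_pdivrMr//.
  by have := truncnS_gt (2 / e); apply.
have k0 : 0 < k.+1%:R^-1 :> R by rewrite invr_gt0.
have /choice[q qP] : forall i : 'I_n, exists q : rat,
    ball (x ord0 i) k.+1%:R^-1 (ratr q).
  move=> i; have := @rat_in_itvoo R (x ord0 i - k.+1%:R^-1) (x ord0 i + k.+1%:R^-1).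
  case; first by rewrite ltrD2l gtrN.
  move=> q; rewrite in_itv/= => /andP[q1 q2]; exists q.
  by rewrite /ball/= ltr_distlC q1 q2.
exists (\row_i q i, k) => /=; last first.
  by move=> i; rewrite mxE; apply: ball_sym; exact: qP.
move=> y /= By; apply: xeU; split => // i j; rewrite !ord1.
apply: le_ball (ltW ke) _ _; rewrite mulr_natl mulr2n.
by apply: ball_triangle (qP j) _; have := By j; rewrite mxE.
Qed.

Lemma continuous_measurable_rV n (f : 'rV[R]_n -> R) :
  continuous f -> measurable_fun setT f.
Proof.
move=> /continuousP cf; apply: (measurability _ (RGenOpens.measurableE R)).
move=> _ [_ [a [b ->] <-]]; rewrite setTI; apply: open_measurable_rV.
exact/cf/interval_open.
Qed.

Lemma row_cons_continuousl n (v : 'rV[R]_n) :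
  continuous (fun a : R => row_cons (a, v)).
Proof.
move=> a; apply/cvg_ballP => e e0; near=> b; split => // i j; rewrite ord1.
case: (unliftP ord0 j) => [k ->|->].
  by rewrite !row_consS/=; exact: ballxx.
by rewrite !row_cons0/=; near: b; exact: (nbhsx_ballx a).
Unshelve. all: by end_near. Qed.

Lemma row_cons_continuousr n (a : R) :
  continuous (fun v : 'rV[R]_n => row_cons (a, v)).
Proof.
move=> v U /= /nbhs_ballP[e /= e0 eU]; apply/nbhs_ballP; exists e => //= w [_ vw].
apply: eU; split => // i j; rewrite ord1.
case: (unliftP ord0 j) => [k ->|->].
  by rewrite !row_consS/=; exact: vw.
by rewrite !row_cons0/=; exact: ballxx.
Qed.

Definition supported_in_box n (A : R) (f : 'rV[R]_n -> R) :=
  forall x, f x != 0 -> forall i, `|x ord0 i| <= A.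

Lemma integrable_box n A (f : 'rV[R]_n -> R) : continuous f ->
  supported_in_box A f -> (lebesgue_rV R n).-integrable setT (EFin \o f).
Proof.
move=> cf fA.
pose D : set 'rV[R]_n := [set x | forall i, `[(- A), A]%classic (x ord0 i)].
have cD : compact D.
  by apply: (@rV_compact R n (fun=> `[(- A), A]%classic)) => i; exact: segment_compact.
have mD : measurable D.
  have -> : D = \bigcap_(i in setT) (fun v : 'rV[R]_n =>
      v ord0 i : measurableTypeR R) @^-1` `[(- A), A]%classic.
    by apply/seteqP; split => [v Av j _|v Av j]; [exact: Av|exact: (Av j)].
  apply: fin_bigcap_measurable => [|j _]; first exact: finite_finset.
  by rewrite -[X in measurable X]setTI; apply: measurable_row_coord.
have Doo : (lebesgue_rV R n D < +oo)%E.
  rewrite (@lebesgue_rV_box R n (fun=> `[(- A), A]%classic) (fun=> measurable_itv _)).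
  rewrite (eq_bigr (fun=> (fine ((@lebesgue_measure R) `[(- A), A]%classic))%:E)).
    by rewrite prodEFin ltry.
  by move=> i _; rewrite fineK// lebesgue_measure_itv/=; case: ifPn.
have fD : f = f \_ D.
  apply/funext => x; rewrite patchE; case: ifPn => // xD.
  apply/eqP; apply: contraNT xD => fx; rewrite inE => i /=.
  by rewrite in_itv/= -ler_norml; exact: fA.
rewrite fD -restrict_EFin; apply: (@integrable_mkcond _ _ _ (lebesgue_rV R n) _ (EFin \o f) mD).1.
apply: measurable_bounded_integrable => //.
- by apply: measurable_funTS; exact: continuous_measurable_rV.
- have cfD : compact (f @` D).
    by apply: continuous_compact => //; exact: continuous_subspaceT.
  have := @compact_bounded R R^o _ cfD.
  by move=> [M [Mr MH]]; exists M; split => // k /MH H x Dx; apply: H; exists x.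
Qed.

(** The entry point for Fubini: by construction the measure in dimension [n.+1] is the image under
    [row_cons] of a product measure, so a change of variables suffices. *)
Lemma integral_rV_cons n (f : 'rV[R]_n.+1 -> \bar R) :
  (lebesgue_rV R n.+1).-integrable setT f ->
  (@lebesgue_measure R \x lebesgue_rV R n)%E.-integrable setT (f \o @row_cons R n) /\
  (\int[lebesgue_rV R n.+1]_x f x =
   \int[@lebesgue_measure R \x lebesgue_rV R n]_p f (row_cons p))%E.
Proof.
move=> /[dup] fi /integrableP[mf foo].
have mrc := @measurable_row_cons R n.
have ifr : (@lebesgue_measure R \x lebesgue_rV R n)%E.-integrable setT (f \o @row_cons R n).
  apply/integrableP; split; first exact: measurableT_comp.
  move: foo; rewrite ge0_integral_pushforward//.
  exact: measurableT_comp.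
split => //.
rewrite /= /row_push integral_pushforward//.
Qed.

End rV_measure.

(** * Divergences of compactly supported fields have zero integral *)

Section divergence.
Context {R : realType}.

(** A directional derivative sees only one line. If [g] maps the line through [a] along [w] to the
    line through [g a] along [v], the two difference quotients are the same function of [h]. This
    serves for slices, coordinates and restrictions to a line. *)
Lemma is_derive_affine (U V W : normedModType R) (f : V -> W) (g : U -> V)
    (a w : U) (v : V) (df : W) :
  (forall h : R, g (h *: w + a) = h *: v + g a) ->
  is_derive (g a) v f df -> is_derive a w (f \o g) df.
Proof.
move=> gE [dfv dfE].
have E : (fun h : R => h^-1 *: ((f \o g) (h *: w + a) - (f \o g) a)) =
         (fun h : R => h^-1 *: (f (h *: v + g a) - f (g a))).
  by apply/funext => h /=; rewrite gE.
by split; [rewrite /derivable E | rewrite /derive E].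
Qed.

Lemma integral_derive_compact (F f : R -> R) (A : R) :
  (forall x : R, is_derive x (1 : R) F (f x)) -> continuous f ->
  (forall x, F x != 0 -> `|x| <= A) -> (forall x, f x != 0 -> `|x| <= A) ->
  (\int[@lebesgue_measure R]_x (f x)%:E = 0)%E.
Proof.
(* [A] may be negative; [B] is positive and exceeds [A], so [F] vanishes at both ends of
   [[-B, B]]. *)
move=> Ff cf FA fA; pose B := `|A| + 1.
have AB : A < B by rewrite /B (le_lt_trans (ler_norm A))// ltrDl.
have B0 : 0 < B by rewrite /B ltr_wpDl.
have cF : continuous F.
  move=> x; apply: differentiable_continuous; apply/derivable1_diffP.
  by have [] := Ff x.
have fE : f = f \_ `[(- B), B].
  apply/funext => x; rewrite patchE; case: ifPn => // xB.
  apply/eqP; apply: contraNT xB => /fA xA; rewrite inE /= in_itv/= -ler_norml.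
  by rewrite (le_trans xA)// ltW.
have F0 x : A < `|x| -> F x = 0.
  by move=> xA; apply/eqP; apply: contraTT xA => /FA; rewrite -leNgt.
rewrite fE; transitivity (\int[lebesgue_measure]_(x in `[(- B)%R, B]) (f x)%:E)%E.
  rewrite [RHS]integral_mkcond; apply: eq_integral => x _.
  by rewrite !patchE; case: ifPn.
rewrite (@continuous_FTC2 R f F)//.
- rewrite !F0 ?subee// ?normrN ger0_norm ?ltW//.
- by rewrite (lt_trans _ B0)// oppr_lt0.
- exact: continuous_subspaceT.
- split.
  + by move=> x _; have [] := Ff x.
  + exact/cvg_at_right_filter/cF.
  + exact/cvg_at_left_filter/cF.
- by move=> x _; rewrite derive1E; have [_ ->] := Ff x.
Qed.

(** Induction on the dimension, with the order of integration chosen so that the inner integral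
    already vanishes: for a direction in the tail the first coordinate is frozen and the induction
    hypothesis applies, for the first direction the tail is frozen and the one-dimensional case
    applies. *)
Lemma integral_partial n (i : 'I_n) A (g g' : 'rV[R]_n -> R) :
  (forall x, is_derive x (delta_mx ord0 i) g (g' x)) -> continuous g' ->
  supported_in_box A g -> supported_in_box A g' ->
  (\int[lebesgue_rV R n]_x (g' x)%:E = 0)%E.
Proof.
elim: n i g g' => [[]//|n IH] i g g' dg cg' gA g'A.
have /integral_rV_cons[int ->] := integrable_box cg' g'A.
case: (unliftP ord0 i) => [j|] iE.
  rewrite -(integral12_prod_meas1 int); apply: integral0_eq => a _.
  apply: (IH j (fun v => g (row_cons (a, v))) (fun v => g' (row_cons (a, v)))).
  - move=> v; apply: (@is_derive_affine _ _ _ g (fun v => row_cons (a, v)) v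
      (delta_mx ord0 j) (delta_mx ord0 i)).
    move=> h; apply/rowP => k.
    transitivity (h * (delta_mx ord0 i : 'rV[R]_n.+1) ord0 k + row_cons (a, v) ord0 k :> R);
      last by rewrite !mxE.
    rewrite iE; case: (unliftP ord0 k) => [l ->|->].
      by rewrite !row_consS/= !mxE !eqxx/= (inj_eq lift_inj).
    by rewrite !row_cons0/= !mxE mulr0 add0r.
  - by move=> v; apply: continuous_comp; [exact: row_cons_continuousr|exact: cg'].
  - by move=> v /gA vA k; have := vA (lift ord0 k); rewrite row_consS.
  - by move=> v /g'A vA k; have := vA (lift ord0 k); rewrite row_consS.
rewrite -(integral21_prod_meas1 int); apply: integral0_eq => v _.
apply: (@integral_derive_compact (fun a => g (row_cons (a, v))) _ A).
- move=> a; apply: (@is_derive_affine _ _ _ g (fun a => row_cons (a, v)) a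
    1 (delta_mx ord0 i)).
  move=> h; apply/rowP => k.
  transitivity (h * (delta_mx ord0 i : 'rV[R]_n.+1) ord0 k + row_cons (a, v) ord0 k :> R);
    last by rewrite !mxE.
  rewrite iE; case: (unliftP ord0 k) => [l ->|->].
    by rewrite !row_consS/= !mxE mulr0 add0r.
  by rewrite !row_cons0/= !mxE !eqxx.
- by move=> a; apply: continuous_comp; [exact: row_cons_continuousl|exact: cg'].
- by move=> a /gA /(_ ord0); rewrite row_cons0.
- by move=> a /g'A /(_ ord0); rewrite row_cons0.
Qed.

End divergence.

(** * Continuity and derivatives of real functions *)

Section calculus.
Context {R : realType}.

Section continuity.
Context {T : topologicalType}.
Implicit Types f g : T -> R.

Lemma fcontinuous_cst (c : R) : continuous (fun _ : T => c).
Proof. by move=> x; exact: cvg_cst. Qed.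

Lemma fcontinuousD f g : continuous f -> continuous g ->
  continuous (fun x => f x + g x).
Proof. by move=> cf cg x; apply: cvgD; [exact: cf|exact: cg]. Qed.

Lemma fcontinuousN f : continuous f -> continuous (fun x => - f x).
Proof. by move=> cf x; apply: cvgN; exact: cf. Qed.

Lemma fcontinuousM f g : continuous f -> continuous g ->
  continuous (fun x => f x * g x).
Proof. by move=> cf cg x; apply: cvgM; [exact: cf|exact: cg]. Qed.

Lemma fcontinuousX f n : continuous f -> continuous (fun x => f x ^+ n).
Proof.
move=> cf; elim: n => [|n IH]; first exact: fcontinuous_cst.
by under eq_fun do rewrite exprS; exact: fcontinuousM.
Qed.

Lemma fcontinuousV f : continuous f -> (forall x, f x != 0) ->
  continuous (fun x => (f x)^-1).
Proof. by move=> cf f0 x; apply: cvgV => //; exact: cf. Qed.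

Lemma fcontinuous_max f g : continuous f -> continuous g ->
  continuous (fun x => Num.max (f x) (g x)).
Proof. by move=> cf cg x; exact: continuous_max (cf x) (cg x). Qed.

Lemma fcontinuous_sum n (F : 'I_n -> T -> R) :
  (forall i, continuous (F i)) -> continuous (fun x => \sum_(i < n) F i x).
Proof.
move=> cF; elim: n F cF => [|n IH] F cF.
  rewrite (_ : (fun _ => _) = fun=> 0); first exact: fcontinuous_cst.
  by apply/funext => x; rewrite big_ord0.
under eq_fun do rewrite big_ord_recl.
by apply: fcontinuousD; [exact: cF|apply: IH => i; exact: cF].
Qed.

End continuity.

Section derivative.
Context {V : normedModType R}.
Implicit Types (f g : V -> R) (x v : V).

Lemma is_derive_fcst (c : R) x v : is_derive x v (fun _ : V => c) 0.
Proof. exact: is_derive_cst. Qed.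

Lemma is_derive_fD f g x v df dg : is_derive x v f df -> is_derive x v g dg ->
  is_derive x v (fun y => f y + g y) (df + dg).
Proof. by move=> *; exact: is_deriveD. Qed.

Lemma is_derive_fN f x v df : is_derive x v f df ->
  is_derive x v (fun y => - f y) (- df).
Proof. by move=> *; exact: is_deriveN. Qed.

Lemma is_derive_fM f g x v df dg : is_derive x v f df -> is_derive x v g dg ->
  is_derive x v (fun y => f y * g y) (df * g x + f x * dg).
Proof.
move=> Hf Hg; apply: (is_derive_eq (is_deriveM Hf Hg)).
by rewrite addrC [df * _]mulrC.
Qed.

Lemma is_derive_fsum n (F : 'I_n -> V -> R) dF x v :
  (forall i, is_derive x v (F i) (dF i)) ->
  is_derive x v (fun y => \sum_(i < n) F i y) (\sum_(i < n) dF i).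
Proof.
move=> dF'; rewrite (_ : (fun _ => _) = \sum_(i < n) F i).
  exact: is_derive_sum.
by apply/funext => y; rewrite fct_sumE.
Qed.

(** Here [g] has a derivative in one direction only, so the chain rule is applied to its restriction
    [k] to the line through [x] along [v]. *)
Lemma is_derive_fcomp (h : R -> R) g x v dg dh : is_derive x v g dg ->
  is_derive (g x) (1 : R) h dh -> is_derive x v (fun y => h (g y)) (dh * dg).
Proof.
move=> Hg Hh; pose k t : R := g (t *: v + x).
have k0 : k 0 = g x by rewrite /k scale0r add0r.
have Hk : is_derive (0 : R) (1 : R) k dg.
  apply: (@is_derive_affine _ R^o V R^o g (fun t : R^o => t *: v + x) 0 1 v).
    by move=> t; rewrite addr0 scale0r add0r [t%:A]mulr1.
  by rewrite scale0r add0r.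
have Hhk : is_derive (0 : R) (1 : R) (h \o k) (dh * dg).
  have [dk kE] := Hk; have [dhg hE] := Hh.
  have dhk0 : derivable h (k 0) 1 by rewrite k0.
  split.
    have /derivable1_diffP Dk := dk; have /derivable1_diffP Dh := dhk0.
    by apply/derivable1_diffP; exact: (differentiable_comp Dk Dh).
  by rewrite -derive1E (derive1_comp dk dhk0) 2!derive1E kE k0 hE.
have [dhk hkE] := Hhk.
have E : (fun t : R => t^-1 *: ((h \o k) (t *: (1 : R) + 0) - (h \o k) 0)) =
  (fun t : R => t^-1 *: (h (g (t *: v + x)) - h (g x))).
  by apply/funext => t /=; rewrite k0 /k addr0 [t%:A]mulr1.
by split; [move: dhk; rewrite /derivable E|move: hkE; rewrite /derive E].
Qed.

End derivative.

Lemma is_derive_quadratic (f : R -> R) (K t l : R) :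
  (forall s, `|f s - f t - l * (s - t)| <= K * (s - t) ^+ 2) ->
  is_derive t (1 : R) f l.
Proof.
move=> H.
have K0 : 0 <= K.
  have := H (t + 1); rewrite [t + 1]addrC addrK expr1n mulr1.
  by rewrite mulr1; apply: le_trans; exact: normr_ge0.
have cv : h^-1 *: (f (h *: (1 : R) + t) - f t) @[h --> 0^'] --> l.
  apply/cvgrPdist_le => e e0; near=> h.
  have h0 : h != 0 by near: h; exact: nbhs_dnbhs_neq.
  have hs : `|h| <= e / (K + 1).
    near: h; apply: dnbhs0_le.
    by rewrite divr_gt0// ltr_wpDl.
  have := H (h + t); rewrite addrK => Hh.
  rewrite [h%:A]mulr1 distrC [_ *: _]mulrC.
  have -> : (f (h + t) - f t) / h - l = (f (h + t) - f t - l * h) / h.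
    by field.
  rewrite normrM normfV ler_pdivrMr ?normr_gt0// (le_trans Hh)//.
  rewrite -real_normK ?num_real// expr2 mulrA ler_wpM2r//.
  rewrite (@le_trans _ _ ((K + 1) * (e / (K + 1))))//.
    by rewrite ler_pM// lerDl.
  by rewrite mulrC divfK// gt_eqF// ltr_wpDl.
split; first by apply/cvg_ex; exists l.
exact/cvg_lim.
Unshelve. all: by end_near. Qed.

(** The reason for squaring the cutoff: the positive part has a kink at [0], but its square has a
    first-order Taylor remainder of at most [(s - t)^2], whatever the signs of [s] and [t]. *)
Lemma is_derive_pospart2 (t : R) :
  is_derive t (1 : R) (fun s => Num.max 0 s ^+ 2) (2 * Num.max 0 t).
Proof.
apply: (@is_derive_quadratic _ 1) => s; rewrite ler_norml !maxEle mul1r.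
have q := sqr_ge0 (s - t); rewrite !expr2 in q *.
have [s0|s0] := leP 0 s; have [t0|t0] := leP 0 t; apply/andP; split; nra.
Qed.

Lemma is_derive_inv (t : R) : t != 0 ->
  is_derive t (1 : R) (fun s => s^-1) (- t ^- 2).
Proof.
move=> t0; apply: is_derive_eq; first exact: is_deriveV.
by rewrite [_ *: _]mulr1.
Qed.

End calculus.

(** * The energy estimate *)

Section pointwise.
Context {R : realType}.

(** One completed square per cross term. A quarter of [kap m^2 |d_i u|^2] absorbs the real cross
    term created by [grad (m^2)]. The imaginary part creates three cross terms, from the drift, from
    [grad psi] and from [grad (m^2)]; each costs one copy of [m^2 |d_i u|^2], and three copies are
    left because [3 kap / 4 >= 3]. *)
Lemma coordinate_lower_bound (kap m N psi s x p q p1 q1 : R) :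
  4 <= kap -> 0 < N -> s ^+ 2 = 1 ->
  - (m ^+ 2 * (p ^+ 2 + q ^+ 2) * (psi ^+ 2 * x ^+ 2 + psi ^+ 4 * x ^+ 2))
  - (16 * kap + 4 * psi ^+ 2) * (x ^+ 2 / N ^+ 2) * (p ^+ 2 + q ^+ 2) <=
  kap * m ^+ 2 * (p1 ^+ 2 + q1 ^+ 2)
  - 4 * kap * (x * m / N) * (p * p1 + q * q1)
  + s * (2 * psi * m ^+ 2 * x - 2 * x * psi ^+ 2 * m ^+ 2 - 4 * psi * x * m / N)
    * (p * q1 - q * p1).
Proof.
move=> k4 N0 s1; rewrite -subr_ge0.
set y := x / N.
have sq (a b : R) : 0 <= a ^+ 2 + b ^+ 2 by rewrite addr_ge0// sqr_ge0.
have h2 := sq (m * p1 - s * psi * x * m * q) (m * q1 + s * psi * x * m * p).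
have h3 := sq (m * p1 + s * x * psi ^+ 2 * m * q) (m * q1 - s * x * psi ^+ 2 * m * p).
have h4 := sq (m * p1 + 2 * s * psi * y * q) (m * q1 - 2 * s * psi * y * p).
have kh1 : 0 <= kap * ((m * p1 / 2 - 4 * y * p) ^+ 2 + (m * q1 / 2 - 4 * y * q) ^+ 2).
  by rewrite mulr_ge0// (le_trans _ k4).
have kh5 : 0 <= (kap - 4) * ((m * p1) ^+ 2 + (m * q1) ^+ 2).
  by rewrite mulr_ge0// subr_ge0.
have -> : x * m / N = y * m by rewrite /y; field; rewrite gt_eqF.
have -> : 4 * psi * x * m / N = 4 * psi * y * m by rewrite /y; field; rewrite gt_eqF.
have -> : x ^+ 2 / N ^+ 2 = y ^+ 2 by rewrite /y exprMn exprVn.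
have H : 0 <= kap * ((m * p1 / 2 - 4 * y * p) ^+ 2 + (m * q1 / 2 - 4 * y * q) ^+ 2)
  + 3/4 * ((kap - 4) * ((m * p1) ^+ 2 + (m * q1) ^+ 2))
  + ((m * p1 - s * psi * x * m * q) ^+ 2 + (m * q1 + s * psi * x * m * p) ^+ 2)
  + ((m * p1 + s * x * psi ^+ 2 * m * q) ^+ 2 + (m * q1 - s * x * psi ^+ 2 * m * p) ^+ 2)
  + ((m * p1 + 2 * s * psi * y * q) ^+ 2 + (m * q1 - 2 * s * psi * y * p) ^+ 2).
  have q34 : 0 <= 3 / 4 :> R by lra.
  apply: addr_ge0 h4; apply: addr_ge0 h3; apply: addr_ge0 h2; apply: addr_ge0 kh1 _.
  exact: mulr_ge0 q34 kh5.
apply: le_trans H _.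
rewrite le_eqVlt; apply/orP; left; apply/eqP.
(* The squares are expanded with [s ^+ 2] kept as a factor, so that it can be rewritten to [1]. *)
transitivity (kap * ((m * p1 / 2 - 4 * y * p) ^+ 2 + (m * q1 / 2 - 4 * y * q) ^+ 2)
  + 3/4 * ((kap - 4) * ((m * p1) ^+ 2 + (m * q1) ^+ 2))
  + (m^+2 * (p1^+2+q1^+2) + s^+2 * (psi * x * m) ^+ 2 * (p^+2+q^+2) + 2 * m * (s * psi * x * m) * (p * q1 - q * p1))
  + (m^+2 * (p1^+2+q1^+2) + s^+2 * (x * psi ^+ 2 * m) ^+ 2 * (p^+2+q^+2) - 2 * m * (s * x * psi^+2 * m) * (p * q1 - q * p1))
  + (m^+2 * (p1^+2+q1^+2) + s^+2 * (2 * psi * y) ^+ 2 * (p^+2+q^+2) - 2 * m * (2 * s * psi * y) * (p * q1 - q * p1))).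
  by field.
by rewrite s1; field.
Qed.


(* From the real part of [(kap - i s psi) m^2 f conj(u)]; the sum on the
   left-hand side is [div (m^2 Y)], [Y' i] being [d_i (Y i)] and
   [- (4 * x i * m / N)] being [d_i (m^2)] for the cutoff below.  The value of [kap]
   leaves enough of [|grad u|^2] and [|u|^2] to absorb all cross terms. *)
Lemma weighted_energy_pointwise d (x p1 q1 p2 q2 : 'I_d -> R)
    (p q m N psi s b omega : R) :
  let X := \sum_(i < d) x i ^+ 2 in
  let kap := 4 + 5 / b in
  let u2 := p ^+ 2 + q ^+ 2 in
  let F := (d%:R + b) * p - omega * q
           - (\sum_(i < d) p2 i - 2 * \sum_(i < d) x i * p1 i) in
  let G := (d%:R + b) * q + omega * p
           - (\sum_(i < d) q2 i - 2 * \sum_(i < d) x i * q1 i) in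
  let Y i := kap * (x i * u2 - (p * p1 i + q * q1 i))
             - s * psi * (p * q1 i - q * p1 i) in
  let Y' i := kap * (u2 + x i * (2 * p * p1 i + 2 * q * q1 i)
                - (p1 i ^+ 2 + p * p2 i + (q1 i ^+ 2 + q * q2 i)))
              - s * (- (2 * x i * psi ^+ 2) * (p * q1 i - q * p1 i)
                     + psi * (p * q2 i - q * p2 i)) in
  0 < b -> 0 < N -> 0 <= m -> m <= 1 -> (0 < m -> X <= N) ->
  psi = (1 + X)^-1 -> s ^+ 2 = 1 -> s * omega = `|omega| ->
  m ^+ 2 * (u2 * (1 + `|omega| * psi))
    + \sum_(i < d) (- (4 * x i * m / N) * Y i + m ^+ 2 * Y' i)
  <= (kap / b + 1) * (F ^+ 2 + G ^+ 2) + (16 * kap + 4) / N * u2.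
Proof.
move=> X kap u2 F G Y Y' b0 N0 m0 m1 mX psiE s1 so.
have k4 : 4 <= kap by rewrite /kap lerDl divr_ge0// ltW.
have k0 : 0 <= kap by rewrite (le_trans _ k4).
have u20 : 0 <= u2 by rewrite /u2 addr_ge0// sqr_ge0.
have FG0 : 0 <= F ^+ 2 + G ^+ 2 by rewrite addr_ge0// sqr_ge0.
have X0 : 0 <= X by rewrite sumr_ge0// => i _; rewrite sqr_ge0.
have psi0 : 0 < psi by rewrite psiE invr_gt0 ltr_wpDr.
have psi1 : psi <= 1 by rewrite psiE invf_le1 ?lerDl// ltr_wpDr.
have psiX : psi * X <= 1.
  by rewrite psiE mulrC ler_pdivrMr ?mul1r ?lerDr// ltr_wpDr.
(* The bound [X <= N] holds only where the cutoff is positive. Where [m = 0] the left-hand side is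
   zero and the right-hand side is nonnegative. *)
move: m0; rewrite le_eqVlt => /predU1P[m0|m0].
  rewrite -m0 expr0n/= mul0r add0r big1 => [|i _]; last first.
    by rewrite mulr0 mul0r oppr0 !mul0r addr0.
  rewrite addr_ge0// mulr_ge0//.
    by rewrite addr_ge0// divr_ge0// ltW.
  by rewrite divr_ge0 ?ltW// addr_gt0// mulr_gt0// (lt_le_trans _ k4).
have XN := mX m0.
pose T i := kap * m ^+ 2 * (p1 i ^+ 2 + q1 i ^+ 2)
  - 4 * kap * (x i * m / N) * (p * p1 i + q * q1 i)
  + s * (2 * psi * m ^+ 2 * x i - 2 * x i * psi ^+ 2 * m ^+ 2 - 4 * psi * x i * m / N)
    * (p * q1 i - q * p1 i).
(* The product rule in the pairing: [d] cancels against the divergence of [x], leaving [kap * b],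
   and the term with [4 * kap] is [- kap x . grad (m^2) |u|^2], which is nonnegative. The choice of
   [s] turns [omega] into its absolute value. *)
have idE : kap * m ^+ 2 * (F * p + G * q) + s * psi * m ^+ 2 * (G * p - F * q) =
  kap * b * m ^+ 2 * u2 + `|omega| * psi * m ^+ 2 * u2 +
  \sum_(i < d) (T i + 4 * kap * (x i ^+ 2 * m / N) * u2
    + (- (4 * x i * m / N) * Y i + m ^+ 2 * Y' i)).
  rewrite -so.
  have -> : kap * m ^+ 2 * (F * p + G * q) + s * psi * m ^+ 2 * (G * p - F * q) =
    kap * b * m ^+ 2 * u2 + s * omega * psi * m ^+ 2 * u2 +
    (kap * m ^+ 2 * u2 *+ d
     - kap * m ^+ 2 * p * \sum_(i < d) p2 i - kap * m ^+ 2 * q * \sum_(i < d) q2 i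
     + 2 * kap * m ^+ 2 * p * (\sum_(i < d) x i * p1 i)
     + 2 * kap * m ^+ 2 * q * (\sum_(i < d) x i * q1 i)
     - s * psi * m ^+ 2 * p * \sum_(i < d) q2 i
     + s * psi * m ^+ 2 * q * \sum_(i < d) p2 i
     + 2 * s * psi * m ^+ 2 * p * (\sum_(i < d) x i * q1 i)
     - 2 * s * psi * m ^+ 2 * q * (\sum_(i < d) x i * p1 i)).
    by rewrite -mulr_natr /F /G /u2; ring.
  congr (_ + _).
  have -> : kap * m ^+ 2 * u2 *+ d = \sum_(i < d) kap * m ^+ 2 * u2.
    by rewrite sumr_const card_ord.
  rewrite !mulr_sumr -!sumrN -!big_split/=; apply: eq_bigr => i _.
  by rewrite /T /Y /Y' /u2; field; rewrite gt_eqF.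
(* The [2] bounds [psi^2 X + psi^4 X], as [psi <= 1] and [psi X <= 1]; the error in [1 / N] comes
   from [X / N^2 <= 1 / N] on the support of the cutoff. *)
have sumT : - (2 * m ^+ 2 * u2) - (16 * kap + 4) / N * u2 <= \sum_(i < d) T i.
  apply: (@le_trans _ _ (\sum_(i < d)
    (- (m ^+ 2 * u2 * (psi ^+ 2 * x i ^+ 2 + psi ^+ 4 * x i ^+ 2))
     - (16 * kap + 4 * psi ^+ 2) * (x i ^+ 2 / N ^+ 2) * u2))); last first.
    by apply: ler_sum => i _; exact: coordinate_lower_bound.
  have -> : \sum_(i < d)
    (- (m ^+ 2 * u2 * (psi ^+ 2 * x i ^+ 2 + psi ^+ 4 * x i ^+ 2))
     - (16 * kap + 4 * psi ^+ 2) * (x i ^+ 2 / N ^+ 2) * u2) =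
    - (m ^+ 2 * u2 * (psi ^+ 2 * X + psi ^+ 4 * X))
     - (16 * kap + 4 * psi ^+ 2) * (X / N ^+ 2) * u2.
    rewrite /X !mulr_sumr !mulr_suml !mulr_sumr -big_split/= !mulr_sumr mulr_suml.
    by rewrite -!sumrN -big_split.
  have psi21 : psi ^+ 2 <= 1 by rewrite expr_le1// ltW.
  have psi20 : 0 <= psi ^+ 2 by rewrite sqr_ge0.
  apply: lerB.
    rewrite lerN2; have -> : 2 * m ^+ 2 * u2 = m ^+ 2 * u2 * 2 by ring.
    apply: ler_wpM2l.
      by rewrite mulr_ge0// sqr_ge0.
    have -> : psi ^+ 2 * X + psi ^+ 4 * X = psi * (psi * X) + psi ^+ 2 * (psi * (psi * X)).
      by ring.
    have h : psi * (psi * X) <= 1.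
      by rewrite -[leRHS]mulr1 ler_pM// ?mulr_ge0// ltW.
    have h0 : 0 <= psi * (psi * X) by rewrite !mulr_ge0// ltW.
    by have := ler_pM psi20 h0 psi21 h; lra.
  apply: ler_wpM2r => //.
  have -> : (16 * kap + 4) / N = (16 * kap + 4) * (N / N ^+ 2).
    by field; rewrite gt_eqF.
  apply: ler_pM.
  - by apply: addr_ge0; apply: mulr_ge0.
  - by rewrite divr_ge0// sqr_ge0.
  - by rewrite lerD2l ler_piMr.
  - by rewrite ler_pM2r// invr_gt0 exprn_gt0.
have drift0 : 0 <= \sum_(i < d) 4 * kap * (x i ^+ 2 * m / N) * u2.
  apply: sumr_ge0 => i _; apply: mulr_ge0 => //; apply: mulr_ge0.
    exact: mulr_ge0.
  by apply: divr_ge0; [apply: mulr_ge0; [exact: sqr_ge0|exact: ltW]|exact: ltW].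
have reh : F * p + G * q <= (F ^+ 2 + G ^+ 2) / b + b / 4 * u2.
  rewrite -subr_ge0.
  have -> : (F ^+ 2 + G ^+ 2) / b + b / 4 * u2 - (F * p + G * q) =
     ((F - b / 2 * p) ^+ 2 + (G - b / 2 * q) ^+ 2) / b.
    by rewrite /u2; field; rewrite gt_eqF.
  rewrite divr_ge0 ?addr_ge0 ?sqr_ge0//; exact: ltW.
have imh : s * psi * (G * p - F * q) <= (F ^+ 2 + G ^+ 2) / 2 + u2 / 2.
  have h1 := sqr_ge0 (G - s * psi * p); have h2 := sqr_ge0 (F + s * psi * q).
  have h3 : s ^+ 2 * psi ^+ 2 * u2 <= u2.
    by rewrite s1 mul1r ler_piMl// expr_le1// ltW.
  rewrite /u2 in h3 *; nra.
have m2 : 0 <= m ^+ 2 by rewrite sqr_ge0.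
have m21 : m ^+ 2 <= 1 by rewrite expr_le1// ltW.
clearbody T; move: idE; rewrite !big_split/= => idE.
have h1 := ler_wpM2l (mulr_ge0 k0 m2) reh.
have h2 := ler_wpM2l m2 imh.
(* The balance of [m^2 |u|^2]: a quarter of [kap * b] pays for [reh], and the remaining
   [3 b + 15 / 4] covers the [2] of [sumT], the [1 / 2] of [imh] and the [1] of the conclusion. This
   fixes the [5] in [kap]; the [4] is the requirement of [coordinate_lower_bound]. *)
have kb : kap * b = 4 * b + 5 by rewrite /kap; field; rewrite gt_eqF.
have h3 : 0 <= m ^+ 2 * u2 by rewrite mulr_ge0.
have h4 : 0 <= b * (m ^+ 2 * u2) by rewrite mulr_ge0// ltW.
have h5 : m ^+ 2 * ((kap / b + 1) * (F ^+ 2 + G ^+ 2)) <= (kap / b + 1) * (F ^+ 2 + G ^+ 2).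
  by rewrite ler_piMl// mulr_ge0// addr_ge0// divr_ge0// ltW.
have h6 : 0 <= m ^+ 2 * (F ^+ 2 + G ^+ 2) by rewrite mulr_ge0.
have e1 : kap * m ^+ 2 * ((F ^+ 2 + G ^+ 2) / b + b / 4 * u2) =
  m ^+ 2 * ((kap / b) * (F ^+ 2 + G ^+ 2)) + (4 * b + 5) / 4 * (m ^+ 2 * u2).
  by rewrite -kb; field; rewrite gt_eqF.
rewrite e1 in h1; rewrite kb in idE.
set sT := \sum_(i < d) T i in sumT idE.
set sD := \sum_(i < d) 4 * _ * _ * _ in drift0 idE.
set sY := \sum_(i < d) _ * Y i in idE *.
set sY' := \sum_(i < d) _ * Y' i in idE *.
move: sT sD sY sY' sumT drift0 idE => {}T sD {}Y {}Y' sumT drift0 idE.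
clear kb s1 so psiE psiX XN mX reh imh e1.
clearbody F G u2 kap. lra.
Qed.

End pointwise.

(** * The cutoff and the integrated inequality *)

Section energy.
Context {R : realType} (d : nat).
Local Notation E := 'rV[R]_d.
Local Notation mu := (lebesgue_rV R d).
Local Notation normc := (@ComplexField.Normc.normc R).

Lemma normc2E (z : R[i]) : normc z ^+ 2 = complex.Re z ^+ 2 + complex.Im z ^+ 2.
Proof. by case: z => a c /=; rewrite sqr_sqrtr// addr_ge0// sqr_ge0. Qed.

Lemma normc_ge0 (z : R[i]) : 0 <= normc z.
Proof. by case: z => a c /=; exact: sqrtr_ge0. Qed.

Lemma Re_sum n (F : 'I_n -> R[i]) :
  complex.Re (\sum_(i < n) F i) = \sum_(i < n) complex.Re (F i).
Proof. by apply: big_morph => // -[a b] [a' b']. Qed.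

Lemma Im_sum n (F : 'I_n -> R[i]) :
  complex.Im (\sum_(i < n) F i) = \sum_(i < n) complex.Im (F i).
Proof. by apply: big_morph => // -[a b] [a' b']. Qed.

Definition sqnorm (x : E) : R := \sum_(i < d) x ord0 i ^+ 2.

Lemma sqnorm_ge0 x : 0 <= sqnorm x.
Proof. by apply: sumr_ge0 => i _; exact: sqr_ge0. Qed.

Lemma continuous_sqnorm : continuous sqnorm.
Proof.
by apply: fcontinuous_sum => i; apply: fcontinuousX; exact: coord_continuous.
Qed.

Lemma is_derive_coord (x : E) i j :
  is_derive x (delta_mx ord0 i) (fun y : E => y ord0 j : R) (i == j)%:R.
Proof.
apply: (@is_derive_affine R _ R^o R^o id (fun y : E => y ord0 j : R^o) x _
  ((i == j)%:R : R^o)).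
by move=> h; rewrite !mxE eqxx/= eq_sym.
Qed.

Lemma is_derive_sqnorm (x : E) i :
  is_derive x (delta_mx ord0 i) sqnorm (2 * x ord0 i).
Proof.
have H j : is_derive x (delta_mx ord0 i) (fun y : E => y ord0 j ^+ 2)
    (if j == i then 2 * x ord0 i else 0).
  under eq_fun do rewrite expr2.
  apply: (is_derive_eq (is_derive_fM (is_derive_coord x i j) (is_derive_coord x i j))).
  rewrite eq_sym; case: eqP => [->|_]; last by rewrite mul0r mulr0 addr0.
  by rewrite mul1r mulr1 mulr_natl mulr2n.
apply: (is_derive_eq (is_derive_fsum H)).
by rewrite -big_mkcond/= big_pred1_eq.
Qed.

(* Its square [m^2] satisfies [x . grad (m^2) <= 0], so the drift commutator has the
   good sign, and [|grad (m^2)|^2 <= (16 / N) m^2], so that term is absorbed. *)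
Definition cutoff (N : R) (x : E) : R := Num.max 0 (1 - sqnorm x / N).

Lemma is_derive_cutoff2 N (x : E) i :
  is_derive x (delta_mx ord0 i) (fun y => cutoff N y ^+ 2)
    (- (4 * x ord0 i * cutoff N x / N)).
Proof.
have H : is_derive x (delta_mx ord0 i) (fun y => 1 - sqnorm y / N)
    (- (2 * x ord0 i / N)).
  apply: (is_derive_eq (is_derive_fD (is_derive_fcst 1 x _) (is_derive_fN
    (is_derive_fM (is_derive_sqnorm x i) (is_derive_fcst N^-1 x _))))).
  by rewrite mulr0 addr0 add0r.
apply: (is_derive_eq (is_derive_fcomp H (is_derive_pospart2 _))).
by rewrite /cutoff; ring.
Qed.

Definition inv_japanese2 (x : E) : R := (1 + sqnorm x)^-1.

Lemma inv_japanese2_ge0 x : 0 <= inv_japanese2 x.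
Proof. by rewrite invr_ge0 addr_ge0// sqnorm_ge0. Qed.

Lemma sqnorm1_neq0 x : 1 + sqnorm x != 0.
Proof. by rewrite gt_eqF// ltr_wpDr// sqnorm_ge0. Qed.

Lemma is_derive_inv_japanese2 (x : E) i :
  is_derive x (delta_mx ord0 i) inv_japanese2
    (- (2 * x ord0 i * inv_japanese2 x ^+ 2)).
Proof.
have H : is_derive x (delta_mx ord0 i) (fun y => 1 + sqnorm y) (2 * x ord0 i).
  apply: (is_derive_eq (is_derive_fD (is_derive_fcst 1 x _) (is_derive_sqnorm x i))).
  by rewrite add0r.
apply: (is_derive_eq (is_derive_fcomp H (is_derive_inv (sqnorm1_neq0 x)))).
by rewrite /inv_japanese2 exprVn; ring.
Qed.

Lemma continuous_cutoff N : continuous (cutoff N).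
Proof.
apply: fcontinuous_max; first exact: fcontinuous_cst.
apply: fcontinuousD; first exact: fcontinuous_cst.
apply: fcontinuousN; apply: fcontinuousM; last exact: fcontinuous_cst.
exact: continuous_sqnorm.
Qed.

Lemma continuous_inv_japanese2 : continuous inv_japanese2.
Proof.
apply: fcontinuousV; last exact: sqnorm1_neq0.
by apply: fcontinuousD; [exact: fcontinuous_cst|exact: continuous_sqnorm].
Qed.

Lemma cutoff_ge0 N x : 0 <= cutoff N x.
Proof. by rewrite /cutoff le_max lexx. Qed.

Lemma cutoff_le1 N x : 0 < N -> cutoff N x <= 1.
Proof.
move=> N0; rewrite /cutoff ge_max ler01 gerBl divr_ge0 ?sqnorm_ge0//.
exact: ltW.
Qed.

Lemma cutoff_gt0 N x : 0 < N -> 0 < cutoff N x -> sqnorm x <= N.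
Proof.
by move=> N0; rewrite /cutoff lt_max ltxx/= subr_gt0 ltr_pdivrMr// mul1r => /ltW.
Qed.

Lemma cutoff_support N (f : E -> R) : 0 < N ->
  (forall x, cutoff N x = 0 -> f x = 0) -> supported_in_box (1 + N) f.
Proof.
move=> N0 f0 x fx i.
have : 0 < cutoff N x.
  rewrite lt_neqAle cutoff_ge0 andbT eq_sym.
  by apply: contraNneq fx => /f0 ->.
move=> /(cutoff_gt0 N0) xN.
have xi : `|x ord0 i| ^+ 2 <= N.
  rewrite real_normK ?num_real// (le_trans _ xN)// /sqnorm (bigD1 i)//=.
  by rewrite lerDl sumr_ge0// => j _; rewrite sqr_ge0.
(* From [2 |x_i| <= 1 + |x_i|^2]; the half-width [1 + N] avoids a square root. *)
have := sqr_ge0 (`|x ord0 i| - 1); have := normr_ge0 (x ord0 i).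
by nra.
Qed.

Section weighted.
Variables (p q : E -> R) (p1 q1 p2 q2 : 'I_d -> E -> R).
Hypotheses (cp : continuous p) (cq : continuous q).
Hypotheses (cp1 : forall i, continuous (p1 i)) (cq1 : forall i, continuous (q1 i)).
Hypotheses (cp2 : forall i, continuous (p2 i)) (cq2 : forall i, continuous (q2 i)).
Hypothesis dp : forall i x, is_derive x (delta_mx ord0 i) p (p1 i x).
Hypothesis dq : forall i x, is_derive x (delta_mx ord0 i) q (q1 i x).
Hypothesis dp1 : forall i x, is_derive x (delta_mx ord0 i) (p1 i) (p2 i x).
Hypothesis dq1 : forall i x, is_derive x (delta_mx ord0 i) (q1 i) (q2 i x).
Variables (b omega N : R).
Hypotheses (b0 : 0 < b) (N0 : 0 < N).
Let kap := 4 + 5 / b.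
(** A sign of [omega] that equals [1] at [0], so that [s ^+ 2 = 1] always holds. *)
Let s : R := if 0 <= omega then 1 else -1.
Let F (x : E) := (d%:R + b) * p x - omega * q x
  - (\sum_(i < d) p2 i x - 2 * \sum_(i < d) x ord0 i * p1 i x).
Let G (x : E) := (d%:R + b) * q x + omega * p x
  - (\sum_(i < d) q2 i x - 2 * \sum_(i < d) x ord0 i * q1 i x).
Let Y (i : 'I_d) (x : E) := kap * (x ord0 i * (p x ^+ 2 + q x ^+ 2) - (p x * p1 i x + q x * q1 i x))
             - s * inv_japanese2 x * (p x * q1 i x - q x * p1 i x).
Let Y' (i : 'I_d) (x : E) := kap * (p x ^+ 2 + q x ^+ 2
                + x ord0 i * (2 * p x * p1 i x + 2 * q x * q1 i x)
                - (p1 i x ^+ 2 + p x * p2 i x + (q1 i x ^+ 2 + q x * q2 i x)))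
              - s * (- (2 * x ord0 i * inv_japanese2 x ^+ 2) * (p x * q1 i x - q x * p1 i x)
                     + inv_japanese2 x * (p x * q2 i x - q x * p2 i x)).
(** The compactly supported field whose divergence, the sum of the [W' i], has zero integral. *)
Let W (i : 'I_d) (x : E) := cutoff N x ^+ 2 * Y i x.
Let W' (i : 'I_d) (x : E) := - (4 * x ord0 i * cutoff N x / N) * Y i x + cutoff N x ^+ 2 * Y' i x.

Let dW i x : is_derive x (delta_mx ord0 i) (W i) (W' i x).
Proof.
have dx : is_derive x (delta_mx ord0 i) (fun y : E => y ord0 i : R) 1.
  by apply: is_derive_eq (is_derive_coord x i i) _; rewrite eqxx.
have dpq : is_derive x (delta_mx ord0 i) (fun y => p y ^+ 2 + q y ^+ 2)
    (2 * p x * p1 i x + 2 * q x * q1 i x).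
  under eq_fun do rewrite !expr2.
  apply: (is_derive_eq (is_derive_fD (is_derive_fM (dp i x) (dp i x))
    (is_derive_fM (dq i x) (dq i x)))).
  by ring.
have dD : is_derive x (delta_mx ord0 i) (fun y => p y * p1 i y + q y * q1 i y)
    (p1 i x ^+ 2 + p x * p2 i x + (q1 i x ^+ 2 + q x * q2 i x)).
  exact: (is_derive_fD (is_derive_fM (dp i x) (dp1 i x))
    (is_derive_fM (dq i x) (dq1 i x))).
have dE : is_derive x (delta_mx ord0 i) (fun y => p y * q1 i y - q y * p1 i y)
    (p x * q2 i x - q x * p2 i x).
  apply: (is_derive_eq (is_derive_fD (is_derive_fM (dp i x) (dq1 i x))
    (is_derive_fN (is_derive_fM (dq i x) (dp1 i x))))).
  by ring.
have dY : is_derive x (delta_mx ord0 i) (Y i) (Y' i x).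
  apply: (is_derive_eq (is_derive_fD
    (is_derive_fM (is_derive_fcst kap x _)
      (is_derive_fD (is_derive_fM dx dpq) (is_derive_fN dD)))
    (is_derive_fN (is_derive_fM
      (is_derive_fM (is_derive_fcst s x _) (is_derive_inv_japanese2 x i)) dE)))).
  by rewrite /Y'; ring.
exact: (is_derive_fM (is_derive_cutoff2 N x i) dY).
Qed.

Let cx i : continuous (fun x : E => x ord0 i : R).
Proof. exact: coord_continuous. Qed.

Let cW' i : continuous (W' i).
Proof.
have cc := @continuous_cutoff N; have cj := continuous_inv_japanese2.
have C (c : R) : continuous (fun _ : E => c) by exact: fcontinuous_cst.
have cpq := fcontinuousD (fcontinuousX (n:=2) cp) (fcontinuousX (n:=2) cq).
have cE := fcontinuousD (fcontinuousM cp (@cq1 i)) (fcontinuousN (fcontinuousM cq (@cp1 i))).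
have cY : continuous (Y i).
  exact: (fcontinuousD
    (fcontinuousM (C kap) (fcontinuousD (fcontinuousM (@cx i) cpq)
      (fcontinuousN (fcontinuousD (fcontinuousM cp (@cp1 i)) (fcontinuousM cq (@cq1 i))))))
    (fcontinuousN (fcontinuousM (fcontinuousM (C s) cj) cE))).
have cY' : continuous (Y' i).
  exact: (fcontinuousD
    (fcontinuousM (C kap) (fcontinuousD
      (fcontinuousD cpq (fcontinuousM (@cx i)
        (fcontinuousD (fcontinuousM (fcontinuousM (C 2) cp) (@cp1 i))
                      (fcontinuousM (fcontinuousM (C 2) cq) (@cq1 i)))))
      (fcontinuousN (fcontinuousD
        (fcontinuousD (fcontinuousX (n:=2) (@cp1 i)) (fcontinuousM cp (@cp2 i)))
        (fcontinuousD (fcontinuousX (n:=2) (@cq1 i)) (fcontinuousM cq (@cq2 i)))))))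
    (fcontinuousN (fcontinuousM (C s) (fcontinuousD
      (fcontinuousM (fcontinuousN (fcontinuousM (fcontinuousM (C 2) (@cx i))
        (fcontinuousX (n:=2) cj))) cE)
      (fcontinuousM cj (fcontinuousD (fcontinuousM cp (@cq2 i))
        (fcontinuousN (fcontinuousM cq (@cp2 i))))))))).
exact: (fcontinuousD
  (fcontinuousM (fcontinuousN (fcontinuousM (fcontinuousM
    (fcontinuousM (C 4) (@cx i)) cc) (C N^-1))) cY)
  (fcontinuousM (fcontinuousX (n:=2) cc) cY')).
Qed.

Let sW i : supported_in_box (1 + N) (W i).
Proof. by apply: cutoff_support => // x x0; rewrite /W x0 expr0n/= mul0r. Qed.

Let sW' i : supported_in_box (1 + N) (W' i).
Proof.
apply: cutoff_support => // x x0.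
by rewrite /W' x0 expr0n/= mulr0 mul0r oppr0 !mul0r addr0.
Qed.

Let u2 (x : E) := p x ^+ 2 + q x ^+ 2.
Let f2 (x : E) := F x ^+ 2 + G x ^+ 2.
Let h (x : E) := u2 x * (1 + `|omega| * inv_japanese2 x).

Let cu2 : continuous u2.
Proof.
by apply: fcontinuousD; apply: fcontinuousX; [exact: cp|exact: cq].
Qed.

Let ch : continuous h.
Proof.
apply: fcontinuousM => //; apply: fcontinuousD; first exact: fcontinuous_cst.
apply: fcontinuousM; first exact: fcontinuous_cst.
exact: continuous_inv_japanese2.
Qed.

Let pointwise x : cutoff N x ^+ 2 * h x + \sum_(i < d) W' i x <=
  (kap / b + 1) * f2 x + (16 * kap + 4) / N * u2 x.
Proof.
have s1 : s ^+ 2 = 1 by rewrite /s; case: ifP; rewrite ?sqrrN expr1n.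
have so : s * omega = `|omega|.
  rewrite /s; have [w_ge0|w_lt0] := leP 0 omega; first by rewrite mul1r ger0_norm.
  by rewrite mulN1r ltr0_norm.
exact: (@weighted_energy_pointwise R d (fun i => x ord0 i) (p1^~ x) (q1^~ x)
  (p2^~ x) (q2^~ x) (p x) (q x) (cutoff N x) N (inv_japanese2 x) s b omega
  b0 N0 (cutoff_ge0 _ _) (cutoff_le1 _ N0) (@cutoff_gt0 N x N0) erefl s1 so).
Qed.

Lemma cutoff_energy :
  mu.-integrable setT (EFin \o u2) -> mu.-integrable setT (EFin \o f2) ->
  (\int[mu]_x (cutoff N x ^+ 2 * h x)%:E <=
   (kap / b + 1)%:E * \int[mu]_x (f2 x)%:E
   + ((16 * kap + 4) / N)%:E * \int[mu]_x (u2 x)%:E)%E.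
Proof.
move=> iu jf.
have iW i := integrable_box (@cW' i) (@sW' i).
have iWs : mu.-integrable setT (EFin \o (fun x => \sum_(i < d) W' i x)).
  rewrite (_ : _ \o _ = fun x => (\sum_(i < d) (W' i x)%:E)%E); last first.
    by apply/funext => x /=; rewrite sumEFin.
  by apply: integrable_sum => // i _; exact: iW.
have intW : (\int[mu]_x (\sum_(i < d) W' i x)%:E = 0)%E.
  under eq_integral do rewrite -sumEFin.
  rewrite integral_sum//.
  by rewrite big1// => i _; exact: (integral_partial (@dW i) (@cW' i) (@sW i) (@sW' i)).
have iF : mu.-integrable setT (fun x => ((kap / b + 1)%:E * (f2 x)%:E)%E).
  exact: integrableZl.
have iU : mu.-integrable setT (fun x => (((16 * kap + 4) / N)%:E * (u2 x)%:E)%E).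
  exact: integrableZl.
rewrite -!integralZl//.
rewrite -integralD//.
(* Subtracting the zero integral of the divergence on the right reduces the claim to [pointwise]
   under the integral sign. *)
rewrite -[leRHS]sube0 -intW -integralB//; last exact: integrableD.
apply: ge0_le_integral => //.
- move=> x _; rewrite lee_fin mulr_ge0 ?sqr_ge0// /h mulr_ge0//.
    by rewrite addr_ge0// sqr_ge0.
  by rewrite addr_ge0// mulr_ge0// inv_japanese2_ge0.
- apply/measurable_EFinP; apply: continuous_measurable_rV.
  apply: fcontinuousM => //; apply: fcontinuousX; exact: continuous_cutoff.
- apply: (measurable_int mu); apply: integrableB => //; exact: integrableD.
- move=> x _; rewrite /= -!EFinM -EFinD lee_fin lerBrDr.
  exact: pointwise.
Qed.

End weighted.

(** * The inequality for a smooth complex function *)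

Section smooth.
Variable u : E -> R[i].
Hypothesis su : smooth u.
Let p (x : E) := complex.Re (u x).
Let q x := complex.Im (u x).
Let p1 i x := complex.Re (partial i u x).
Let q1 i x := complex.Im (partial i u x).
Let p2 i x := complex.Re (partials [:: i; i] u x).
Let q2 i x := complex.Im (partials [:: i; i] u x).

Let cp : continuous p.
Proof. have [H _ _] := su [::]; exact: H. Qed.
Let cq : continuous q.
Proof. have [_ H _] := su [::]; exact: H. Qed.
Let cp1 i : continuous (p1 i).
Proof. have [H _ _] := su [:: i]; exact: H. Qed.
Let cq1 i : continuous (q1 i).
Proof. have [_ H _] := su [:: i]; exact: H. Qed.
Let cp2 i : continuous (p2 i).
Proof. have [H _ _] := su [:: i; i]; exact: H. Qed.
Let cq2 i : continuous (q2 i).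
Proof. have [_ H _] := su [:: i; i]; exact: H. Qed.
Let dp i x : is_derive x (delta_mx ord0 i) p (p1 i x).
Proof. by have [_ _ /(_ i x)[H _]] := su [::]; exact/derivableP/H. Qed.
Let dq i x : is_derive x (delta_mx ord0 i) q (q1 i x).
Proof. by have [_ _ /(_ i x)[_ H]] := su [::]; exact/derivableP/H. Qed.
Let dp1 i x : is_derive x (delta_mx ord0 i) (p1 i) (p2 i x).
Proof. by have [_ _ /(_ i x)[H _]] := su [:: i]; exact/derivableP/H. Qed.
Let dq1 i x : is_derive x (delta_mx ord0 i) (q1 i) (q2 i x).
Proof. by have [_ _ /(_ i x)[_ H]] := su [:: i]; exact/derivableP/H. Qed.

Lemma Re_shifted_ou (lam omega : R) x :
  complex.Re (shifted (lam +i* omega) (u, ou_expr u) x) =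
  lam * p x - omega * q x
    - (\sum_(i < d) p2 i x - 2 * \sum_(i < d) x ord0 i * p1 i x).
Proof.
rewrite /shifted/= /ou_expr /laplacian /drift.
have -> : forall z w : R[i], complex.Re (z - w) = complex.Re z - complex.Re w.
  by case=> ? ? [].
have -> : forall z w : R[i], complex.Re (z - 2 * w) = complex.Re z - 2 * complex.Re w.
  by case=> ? ? [] ? ? /=; ring.
rewrite !Re_sum/=; congr (_ - _).
  by rewrite /p /q; case: (u x) => ? ? /=.
congr (_ - 2 * _); apply: eq_bigr => i _.
by rewrite /p1/=; ring.
Qed.

Lemma Im_shifted_ou (lam omega : R) x :
  complex.Im (shifted (lam +i* omega) (u, ou_expr u) x) =
  lam * q x + omega * p x
    - (\sum_(i < d) q2 i x - 2 * \sum_(i < d) x ord0 i * q1 i x).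
Proof.
rewrite /shifted/= /ou_expr /laplacian /drift.
have -> : forall z w : R[i], complex.Im (z - w) = complex.Im z - complex.Im w.
  by case=> ? ? [].
have -> : forall z w : R[i], complex.Im (z - 2 * w) = complex.Im z - 2 * complex.Im w.
  by case=> ? ? [] ? ? /=; ring.
rewrite !Im_sum/=; congr (_ - _).
  by rewrite /p /q; case: (u x) => ? ? /=.
congr (_ - 2 * _); apply: eq_bigr => i _.
by rewrite /q1/=; ring.
Qed.

Lemma smooth_cutoff_energy (b omega N : R) :
  let f := shifted ((d%:R + b) +i* omega) (u, ou_expr u) in
  0 < b -> 0 < N ->
  mu.-integrable setT (fun x => (normc (u x) ^+ 2)%:E) ->
  mu.-integrable setT (fun x => (normc (f x) ^+ 2)%:E) ->
  (\int[mu]_x (cutoff N x ^+ 2 * (normc (u x) ^+ 2 *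
      (1 + `|omega| * inv_japanese2 x)))%:E <=
   ((4 + 5 / b) / b + 1)%:E * \int[mu]_x (normc (f x) ^+ 2)%:E
   + ((16 * (4 + 5 / b) + 4) / N)%:E * \int[mu]_x (normc (u x) ^+ 2)%:E)%E.
Proof.
move=> f b0 N0.
have uE x : normc (u x) ^+ 2 = p x ^+ 2 + q x ^+ 2 by rewrite normc2E.
have fE x : normc (f x) ^+ 2 =
    ((d%:R + b) * p x - omega * q x
      - (\sum_(i < d) p2 i x - 2 * \sum_(i < d) x ord0 i * p1 i x)) ^+ 2 +
    ((d%:R + b) * q x + omega * p x
      - (\sum_(i < d) q2 i x - 2 * \sum_(i < d) x ord0 i * q1 i x)) ^+ 2.
  by rewrite normc2E Re_shifted_ou Im_shifted_ou.
have uF : (fun x => (normc (u x) ^+ 2)%:E) = EFin \o (fun x => p x ^+ 2 + q x ^+ 2).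
  by apply/funext => x /=; rewrite uE.
have fF : (fun x => (normc (f x) ^+ 2)%:E) = EFin \o (fun x =>
    ((d%:R + b) * p x - omega * q x
      - (\sum_(i < d) p2 i x - 2 * \sum_(i < d) x ord0 i * p1 i x)) ^+ 2 +
    ((d%:R + b) * q x + omega * p x
      - (\sum_(i < d) q2 i x - 2 * \sum_(i < d) x ord0 i * q1 i x)) ^+ 2).
  by apply/funext => x /=; rewrite fE.
rewrite uF fF; under eq_integral do rewrite uE.
exact: (cutoff_energy cp cq cp1 cq1 cp2 cq2 dp dq dp1 dq1 b0 N0).
Qed.

End smooth.
End energy.

(** * Removal of the cutoff *)

Section energy_limit.
Context {R : realType} (d : nat).
Local Notation E := 'rV[R]_d.
Local Notation mu := (lebesgue_rV R d).
Local Notation normc := (@ComplexField.Normc.normc R).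

(** With [N = n + 1], [cutoff N ^+ 2] increases pointwise to [1], so monotone convergence handles
    the left-hand side; on the right the extra term is a constant over [N] times the finite integral
    of [|u|^2]. *)
Lemma energy_estimate (u : E -> R[i]) (su : smooth u) (b omega : R) :
  let f := shifted ((d%:R + b) +i* omega) (u, ou_expr u) in
  0 < b ->
  mu.-integrable setT (fun x => (normc (u x) ^+ 2)%:E) ->
  mu.-integrable setT (fun x => (normc (f x) ^+ 2)%:E) ->
  (\int[mu]_x (normc (u x) ^+ 2 * (1 + `|omega| * inv_japanese2 x))%:E <=
   ((4 + 5 / b) / b + 1)%:E * \int[mu]_x (normc (f x) ^+ 2)%:E)%E.
Proof.
move=> f b0 iu jf; pose h (x : E) := normc (u x) ^+ 2 * (1 + `|omega| * inv_japanese2 x).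
rewrite -/h -[X in (X <= _)%E]/(\int[mu]_x (h x)%:E)%E.
have mu2 : measurable_fun setT (fun x => normc (u x) ^+ 2).
  by apply/measurable_EFinP; exact: measurable_int iu.
have h0 x : 0 <= h x.
  rewrite /h mulr_ge0 ?sqr_ge0// addr_ge0// mulr_ge0//.
  exact: inv_japanese2_ge0.
have mh : measurable_fun setT h.
  apply: measurable_funM => //; apply: continuous_measurable_rV.
  apply: fcontinuousD; first exact: fcontinuous_cst.
  apply: fcontinuousM; first exact: fcontinuous_cst.
  exact: continuous_inv_japanese2.
pose g n x : \bar R := (cutoff n.+1%:R x ^+ 2 * h x)%:E.
have mg n : measurable_fun setT (g n).
  apply/measurable_EFinP; apply: measurable_funM => //.
  apply: continuous_measurable_rV; apply: fcontinuousX.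
  exact: continuous_cutoff.
have g0 n x : setT x -> (0 <= g n x)%E.
  by move=> _; rewrite lee_fin mulr_ge0// sqr_ge0.
have ndg x : setT x -> {homo g^~ x : n m / (n <= m)%N >-> (n <= m)%E}.
  move=> _ n m nm; rewrite lee_fin ler_wpM2r// lerXn2r ?nnegrE ?cutoff_ge0//.
  rewrite /cutoff ge_max !le_max lexx/= lerD2l lerN2; apply/orP; right.
  by rewrite ler_wpM2l ?sqnorm_ge0// lef_pV2 ?posrE// ler_nat.
have gh x : g n x @[n --> \oo] --> (h x)%:E.
  apply: cvg_EFin; first by near=> n.
  rewrite /= [X in _ --> X](_ : _ = (1 - 0) ^+ 2 * h x); last first.
    by rewrite subr0 expr1n mul1r.
  apply: cvgM; last exact: cvg_cst.
  rewrite expr2; under eq_fun do rewrite expr2.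
  suff cc : cutoff n.+1%:R x @[n --> \oo] --> (1 - 0 : R) by exact: cvgM.
  apply: (@squeeze_cvgr _ _ _ _ (fun n => 1 - sqnorm x * n.+1%:R^-1) (fun=> 1)).
  - by near=> n; rewrite cutoff_le1// andbT /cutoff le_max lexx orbT.
  - apply: cvgB; first exact: cvg_cst.
    rewrite -[X in _ --> X](mulr0 (sqnorm x)); apply: cvgM; first exact: cvg_cst.
    exact: cvg_harmonic.
  - by rewrite subr0; exact: cvg_cst.
have cvh : (\int[mu]_x g n x)%E @[n --> \oo] --> (\int[mu]_x (h x)%:E)%E.
  rewrite (_ : (\int[mu]_x (h x)%:E)%E = (\int[mu]_x limn (g^~ x))%E).
    exact: cvg_monotone_convergence.
  by apply: eq_integral => x _; rewrite (cvg_lim _ (gh x)).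
have fA : (\int[mu]_x (normc (f x) ^+ 2)%:E)%E \is a fin_num by exact: integrable_fin_num.
have fB : (\int[mu]_x (normc (u x) ^+ 2)%:E)%E \is a fin_num by exact: integrable_fin_num.
apply/lee_addgt0Pr => e e0.
rewrite -(cvg_lim _ cvh)//; apply: lime_le; first by apply/cvg_ex; eexists; exact: cvh.
set B := fine (\int[mu]_x (normc (u x) ^+ 2)%:E)%E.
have B0 : 0 <= B by rewrite fine_ge0// integral_ge0// => x _; rewrite lee_fin sqr_ge0.
near=> n.
apply: le_trans (smooth_cutoff_energy su b0 (ltr0Sn _ n) iu jf) _.
rewrite leeD2l//= -(fineK fB) -EFinM lee_fin -/B.
rewrite mulrAC ler_pdivrMr// mulrC -[leRHS]mulrC -ler_pdivrMr//.
apply: (@le_trans _ _ n%:R); last by rewrite ler_nat.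
by near: n; exact: nbhs_infty_ger.
Unshelve. all: by end_near. Qed.



End energy_limit.

(** * The norm and the completeness of L^2 *)

Section L2_norm.
Context {R : realType} (d : nat).
Local Notation E := 'rV[R]_d.
Local Notation mu := (lebesgue_rV R d).
Local Notation normc := (@ComplexField.Normc.normc R).
Implicit Types f g h : E -> R[i].

Definition sqint f : \bar R := (\int[mu]_x (normc (f x) ^+ 2)%:E)%E.

Lemma L2normE f : L2norm f = (sqint f `^ 2^-1)%E.
Proof.
rewrite /L2norm unlock; congr (_ `^ _)%E; apply: eq_integral => x _.
by rewrite abse_EFin poweR_EFin (ger0_norm (normc_ge0 _)) powR_mulrn// normc_ge0.
Qed.

Lemma sqint_ge0 f : (0 <= sqint f)%E.
Proof. by apply: integral_ge0 => x _; rewrite lee_fin sqr_ge0. Qed.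

Lemma L2norm_ge0 f : (0 <= L2norm f)%E.
Proof. exact: Lnorm_ge0. Qed.

Lemma sqint_L2norm f : sqint f = (L2norm f `^ 2)%E.
Proof.
rewrite L2normE -poweRrM mulVf// poweRe1//; exact: sqint_ge0.
Qed.

Lemma L2norm_le_sqint c f g : 0 <= c ->
  (sqint f <= (c ^+ 2)%:E * sqint g)%E -> (L2norm f <= c%:E * L2norm g)%E.
Proof.
move=> c0 fg; rewrite !L2normE.
have -> : c%:E = ((c ^+ 2)%:E `^ 2^-1)%E.
  by rewrite poweR12_sqrt ?lee_fin ?sqr_ge0//= sqrtr_sqr ger0_norm.
rewrite -poweRM ?lee_fin ?sqr_ge0 ?sqint_ge0//.
apply: gt0_ler_poweR => //; rewrite in_itv/= ?leey ?andbT ?sqint_ge0//.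
by rewrite mule_ge0 ?lee_fin ?sqr_ge0 ?sqint_ge0.
Qed.

Lemma cmeasurable_normc f : cmeasurable f ->
  measurable_fun setT (fun x => normc (f x)).
Proof.
move=> [mr mi].
rewrite (_ : (fun _ => _) = Num.sqrt \o
    (fun x => complex.Re (f x) ^+ 2 + complex.Im (f x) ^+ 2)); last first.
  by apply/funext => x /=; case: (f x).
apply: measurableT_comp.
  by apply: continuous_measurable_fun; exact: sqrt_continuous.
by apply: measurable_funD; exact: measurable_funX.
Qed.

Lemma cmeasurableD f g : cmeasurable f -> cmeasurable g ->
  cmeasurable (fun x => f x + g x).
Proof.
move=> [fr fi] [gr gi]; split.
  rewrite (_ : (fun _ => _) = fun x => complex.Re (f x) + complex.Re (g x)).
    exact: measurable_funD.
  by apply/funext => x; case: (f x) (g x) => ? ? [].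
rewrite (_ : (fun _ => _) = fun x => complex.Im (f x) + complex.Im (g x)).
  exact: measurable_funD.
by apply/funext => x; case: (f x) (g x) => ? ? [].
Qed.

Lemma cmeasurableM f g : cmeasurable f -> cmeasurable g ->
  cmeasurable (fun x => f x * g x).
Proof.
move=> [fr fi] [gr gi]; split.
  rewrite (_ : (fun _ => _) = fun x => complex.Re (f x) * complex.Re (g x)
      - complex.Im (f x) * complex.Im (g x)).
    by apply: measurable_funB; exact: measurable_funM.
  by apply/funext => x; case: (f x) (g x) => ? ? [].
rewrite (_ : (fun _ => _) = fun x => complex.Re (f x) * complex.Im (g x)
    + complex.Im (f x) * complex.Re (g x)).
  by apply: measurable_funD; exact: measurable_funM.
by apply/funext => x; case: (f x) (g x) => ? ? [].
Qed.

Lemma cmeasurable_cst (z : R[i]) : cmeasurable (fun _ : E => z).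
Proof. by split; exact: measurable_cst. Qed.

Lemma cmeasurableB f g : cmeasurable f -> cmeasurable g ->
  cmeasurable (fun x => f x - g x).
Proof.
move=> mf mg.
rewrite (_ : (fun _ => _) = fun x => f x + (-1) * g x).
  by apply: cmeasurableD => //; apply: cmeasurableM => //; exact: cmeasurable_cst.
by apply/funext => x; rewrite mulN1r.
Qed.

Lemma L2norm_le c f g : 0 <= c -> cmeasurable f -> cmeasurable g ->
  (forall x, normc (f x) <= c * normc (g x)) -> (L2norm f <= c%:E * L2norm g)%E.
Proof.
move=> c0 mf mg fg; apply: L2norm_le_sqint => //.
have mn h : cmeasurable h -> measurable_fun setT (fun x => (normc (h x) ^+ 2)%:E).
  move=> mh; apply/measurable_EFinP; apply: measurable_funX.
  exact: cmeasurable_normc.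
rewrite /sqint -ge0_integralZl//; first last.
- by rewrite lee_fin sqr_ge0.
- by move=> x _; rewrite lee_fin sqr_ge0.
- exact: mn.
apply: ge0_le_integral => //.
- by move=> x _; rewrite lee_fin sqr_ge0.
- exact: mn.
- by apply: measurable_funeM; exact: mn.
move=> x _; rewrite -EFinM lee_fin -exprMn lerXn2r ?nnegrE ?normc_ge0//.
by rewrite mulr_ge0// normc_ge0.
Qed.

(** Minkowski's inequality for the real moduli, combined with the pointwise triangle inequality. *)
Lemma L2normD_le f g : cmeasurable f -> cmeasurable g ->
  (L2norm (fun x => f x + g x)%R <= L2norm f + L2norm g)%E.
Proof.
move=> mf mg; have mnf := cmeasurable_normc mf; have mng := cmeasurable_normc mg.
apply: le_trans (minkowski_EFin mu mnf mng (ler1n _ 2)).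
rewrite -[leLHS]/(L2norm _) L2normE unlock.
have eN : (\int[mu]_x `|(normc (f x) + normc (g x))%:E| `^ 2 =
    \int[mu]_x ((normc (f x) + normc (g x)) ^+ 2)%:E)%E.
  apply: eq_integral => x _.
  rewrite abse_EFin poweR_EFin ger0_norm ?addr_ge0 ?normc_ge0//.
  by rewrite powR_mulrn ?addr_ge0 ?normc_ge0.
rewrite [leRHS](_ : _ = ((\int[mu]_x ((normc (f x) + normc (g x)) ^+ 2)%:E) `^ 2^-1)%E);
  last exact: (congr1 (fun z => (z `^ 2^-1)%E) eN).
apply: gt0_ler_poweR => //; rewrite ?in_itv/= ?leey ?andbT ?sqint_ge0//.
  by apply: integral_ge0 => x _; rewrite lee_fin sqr_ge0.
apply: ge0_le_integral => //.
- by move=> x _; rewrite lee_fin sqr_ge0.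
- apply/measurable_EFinP; apply: measurable_funX; apply: cmeasurable_normc.
  exact: cmeasurableD.
- by apply/measurable_EFinP; apply: measurable_funX; exact: measurable_funD.
move=> x _; rewrite lee_fin lerXn2r ?nnegrE ?addr_ge0 ?normc_ge0//.
exact: (le_normcD (f x) (g x)).
Qed.

End L2_norm.

Section L2_real_norm.
Context {R : realType} {d : nat}.
Local Notation E := 'rV[R]_d.
Local Notation mu := (lebesgue_rV R d).
Local Notation normc := (@ComplexField.Normc.normc R).
Implicit Types f g h w : E -> R[i].

(** A real-valued norm makes linear arithmetic available. As [fine] sends [+oo] to [0], upper bounds
    on [nrm] carry information only for members of [L2]. *)
Definition nrm f : R := fine (L2norm f).

Lemma nrm_ge0 f : 0 <= nrm f.
Proof. by rewrite fine_ge0// L2norm_ge0. Qed.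

Lemma L2normK f : L2 f -> L2norm f = (nrm f)%:E.
Proof. by move=> [_ foo]; rewrite fineK// ge0_fin_numE// L2norm_ge0. Qed.

Lemma L2D f g : L2 f -> L2 g -> L2 (fun x => f x + g x).
Proof.
move=> Lf Lg; split; first exact: cmeasurableD Lf.1 Lg.1.
apply: le_lt_trans (L2normD_le Lf.1 Lg.1) _.
by rewrite !L2normK// -EFinD ltry.
Qed.

Lemma nrmD f g : L2 f -> L2 g -> nrm (fun x => f x + g x) <= nrm f + nrm g.
Proof.
move=> Lf Lg; rewrite -lee_fin EFinD -!L2normK//; last exact: L2D.
exact: L2normD_le Lf.1 Lg.1.
Qed.

Lemma L2_le c f g : 0 <= c -> cmeasurable f -> L2 g ->
  (forall x, normc (f x) <= c * normc (g x)) -> L2 f /\ nrm f <= c * nrm g.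
Proof.
move=> c0 mf Lg fg; have := L2norm_le c0 mf Lg.1 fg; rewrite (L2normK Lg) -EFinM => H.
have Lf : L2 f by split => //; rewrite (le_lt_trans H)// ltry.
by split => //; rewrite -lee_fin -L2normK.
Qed.

Lemma L2_mul c w f : 0 <= c -> cmeasurable w -> (forall x, normc (w x) <= c) ->
  L2 f -> L2 (fun x => w x * f x) /\ nrm (fun x => w x * f x) <= c * nrm f.
Proof.
move=> c0 mw wc Lf; apply: L2_le => //; first exact: cmeasurableM mw Lf.1.
by move=> x; rewrite ComplexField.Normc.normcM ler_wpM2r// normc_ge0.
Qed.

Lemma L2Z (z : R[i]) f : L2 f ->
  L2 (fun x => z * f x) /\ nrm (fun x => z * f x) <= normc z * nrm f.
Proof.
by move=> Lf; apply: L2_mul => //; exact: normc_ge0.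
Qed.

Lemma L2B f g : L2 f -> L2 g -> L2 (fun x => f x - g x).
Proof.
move=> Lf Lg; rewrite (_ : (fun _ => _) = fun x => f x + (-1) * g x).
  by apply: L2D => //; have [] := L2Z (-1) Lg.
by apply/funext => x; rewrite mulN1r.
Qed.

Lemma nrm_le f g : L2 f -> L2 g -> (forall x, normc (f x) <= normc (g x)) ->
  nrm f <= nrm g.
Proof.
move=> Lf Lg fg; rewrite -[leRHS]mul1r.
by apply: (proj2 (L2_le ler01 Lf.1 Lg _)) => x; rewrite mul1r.
Qed.

Lemma nrmBC f g : L2 f -> L2 g -> nrm (fun x => f x - g x) = nrm (fun x => g x - f x).
Proof.
have H f' g' : L2 f' -> L2 g' ->
    nrm (fun x => f' x - g' x) <= nrm (fun x => g' x - f' x).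
  move=> Lf Lg; apply: (nrm_le (L2B Lf Lg) (L2B Lg Lf)) => x.
  by rewrite -normcN opprB.
by move=> Lf Lg; apply/eqP; rewrite eq_le !H.
Qed.

Lemma nrm_triangle f g h : L2 f -> L2 g -> L2 h ->
  nrm (fun x => f x - h x) <= nrm (fun x => f x - g x) + nrm (fun x => g x - h x).
Proof.
move=> Lf Lg Lh; rewrite [leLHS](_ : _ = nrm (fun x => (f x - g x) + (g x - h x))).
  by apply: nrmD; exact: L2B.
by congr nrm; apply/funext => x; rewrite addrA subrK.
Qed.

Lemma nrmB f g : L2 f -> L2 g -> nrm (fun x => f x - g x) <= nrm f + nrm g.
Proof.
move=> Lf Lg; rewrite [leLHS](_ : _ = nrm (fun x => f x + (-1) * g x)).
  have [Lg' le] := L2Z (-1) Lg.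
  rewrite (le_trans (nrmD Lf Lg'))// lerD2l (le_trans le)// normcN.
  by rewrite ComplexField.Normc.normc1 mul1r.
by congr nrm; apply/funext => x; rewrite mulN1r.
Qed.

Lemma measurable_normc2 f : cmeasurable f ->
  measurable_fun setT (fun x => (normc (f x) ^+ 2)%:E).
Proof.
by move=> mf; apply/measurable_EFinP; apply: measurable_funX;
  exact: cmeasurable_normc.
Qed.

Lemma sqint_nrm f : L2 f -> sqint f = (nrm f ^+ 2)%:E.
Proof.
move=> Lf; rewrite sqint_L2norm (L2normK Lf) poweR_EFin powR_mulrn//.
exact: nrm_ge0.
Qed.

Lemma sqint_le_L2 f c : 0 <= c -> cmeasurable f -> (sqint f <= (c ^+ 2)%:E)%E ->
  L2 f /\ nrm f <= c.
Proof.
move=> c0 mf fc.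
have H : (L2norm f <= c%:E)%E.
  rewrite L2normE.
  have -> : c%:E = ((c ^+ 2)%:E `^ 2^-1)%E.
    by rewrite poweR12_sqrt ?lee_fin ?sqr_ge0//= sqrtr_sqr ger0_norm.
  apply: gt0_ler_poweR => //; rewrite in_itv/= ?leey ?andbT ?sqint_ge0//.
  by rewrite lee_fin sqr_ge0.
have Lf : L2 f by split => //; rewrite (le_lt_trans H)// ltry.
by split => //; rewrite -lee_fin -L2normK.
Qed.

Lemma integrable_normc2 f : L2 f -> mu.-integrable setT (fun x => (normc (f x) ^+ 2)%:E).
Proof.
move=> Lf; apply/integrableP; split; first exact: measurable_normc2 Lf.1.
under eq_integral do rewrite gee0_abs ?lee_fin ?sqr_ge0//.
by have := sqint_nrm Lf; rewrite /sqint => ->; rewrite ltry.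
Qed.

Lemma L2norm_ae_eq f g : cmeasurable f -> cmeasurable g -> ae_equal f g ->
  L2norm f = L2norm g.
Proof.
move=> mf mg fg; rewrite !L2normE; congr (_ `^ _)%E.
apply: ge0_ae_eq_integral => //; try exact: measurable_normc2.
- by move=> x _; rewrite lee_fin sqr_ge0.
- by move=> x _; rewrite lee_fin sqr_ge0.
by apply: filterS fg => x fgx _; rewrite /= fgx.
Qed.

Lemma nrm_eq0 f g : L2 f -> L2 g -> nrm (fun x => f x - g x) = 0 -> ae_equal f g.
Proof.
move=> Lf Lg fg0.
have Lfg := L2B Lf Lg.
have mn : measurable_fun setT (fun x => (normc (f x - g x))%:E).
  by apply/measurable_EFinP; exact: (cmeasurable_normc Lfg.1).
have p2 : (0 < 2%:E :> \bar R)%E by rewrite lte_fin.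
have /(Lnorm_eq0_eq0 mn p2) : L2norm (fun x => f x - g x) = 0%E.
  by rewrite (L2normK Lfg) fg0.
apply: filterS => x /(_ I) /= [] /ComplexField.Normc.eq0_normc.
by move=> /eqP; rewrite subr_eq0 => /eqP.
Qed.

End L2_real_norm.

(** * Completeness of L^2, for sequences with geometrically decreasing increments *)

Section riesz_fischer.
Context {R : realType} {d : nat}.
Local Notation E := 'rV[R]_d.
Local Notation mu := (lebesgue_rV R d).
Local Notation normc := (@ComplexField.Normc.normc R).
Variables (u : nat -> E -> R[i]) (c : R).
Hypothesis Lu : forall n, L2 (u n).
Hypothesis uc : forall n, nrm (fun x => u n.+1 x - u n x) <= c * 2^-1 ^+ n.

Let c0 : 0 <= c.
Proof. by have := le_trans (nrm_ge0 _) (uc 0); rewrite expr0 mulr1. Qed.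

Let half_sum m N :
  \sum_(0 <= k < N) c * 2^-1 ^+ (m + k) <= 2 * c * 2^-1 ^+ m.
Proof.
rewrite (eq_bigr (fun k => geometric (c * 2^-1 ^+ m) 2^-1 k)); last first.
  by move=> k _ /=; rewrite exprD mulrA.
rewrite -[leLHS]/(series (geometric (c * 2^-1 ^+ m) 2^-1) N).
apply: le_trans (geometric_le_lim _ _ _ _) _.
- by rewrite mulr_ge0// exprn_ge0.
- by [].
- by rewrite ger0_norm// invf_lt1// ltr1n.
have -> : (1 - 2^-1)^-1 = 2 :> R by field.
by rewrite mulrC mulrA.
Qed.

Let D k x : R := normc (u k.+1 x - u k x).
(** Dominates the variation of [u] up to step [N] at [x]: where these sums stay bounded, [u n x]
    converges. *)
Let S N x : R := \sum_(0 <= k < N) D k x.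

Let D0 k x : 0 <= D k x. Proof. exact: normc_ge0. Qed.

Let S_L2 N : L2 (fun x => (S N x)%:C) /\
  nrm (fun x => (S N x)%:C) <= \sum_(0 <= k < N) c * 2^-1 ^+ k.
Proof.
elim: N => [|N [LS IH]].
  have L0 : L2 (fun _ : E => 0 : R[i]).
    have [+ _] := L2Z 0 (Lu 0); congr L2.
    by apply/funext => x; rewrite mul0r.
  rewrite (_ : (fun _ => _) = (fun _ : E => 0 : R[i])); last first.
    by apply/funext => x; rewrite /S big_geq.
  split => //; rewrite big_geq//.
  have [_ +] := L2Z 0 (Lu 0); rewrite ComplexField.Normc.normc0 mul0r.
  by apply: le_trans; rewrite le_eqVlt; apply/orP; left; apply/eqP; congr nrm;
    apply/funext => x; rewrite mul0r.
have Ld := L2B (Lu N.+1) (Lu N).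
have mD : cmeasurable (fun x => (D N x)%:C).
  by split => /=; [exact: (cmeasurable_normc Ld.1)|exact: measurable_cst].
have [LD leD] : L2 (fun x => (D N x)%:C) /\ nrm (fun x => (D N x)%:C) <= 1 * nrm (fun x => u N.+1 x - u N x).
  apply: L2_le => // x.
  by rewrite mul1r /= expr0n/= addr0 sqrtr_sqr ger0_norm.
have -> : (fun x => (S N.+1 x)%:C) = (fun x => (S N x)%:C + (D N x)%:C).
  by apply/funext => x; rewrite /S big_nat_recr//= rmorphD.
split; first exact: L2D.
rewrite big_nat_recr//= (le_trans (nrmD LS LD))// lerD//.
by rewrite (le_trans leD)// mul1r.
Qed.

Let nrm_tail m N : nrm (fun x => u m x - u (m + N)%N x) <= 2 * c * 2^-1 ^+ m.
Proof.
suff : nrm (fun x => u m x - u (m + N)%N x) <= \sum_(0 <= k < N) c * 2^-1 ^+ (m + k).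
  by move/le_trans; apply; exact: half_sum.
elim: N => [|N IH].
  rewrite big_geq//.
  have [_ +] := L2Z 0 (Lu 0); rewrite ComplexField.Normc.normc0 mul0r.
  by apply: le_trans; rewrite le_eqVlt; apply/orP; left; apply/eqP; congr nrm;
    apply/funext => x; rewrite mul0r addn0 subrr.
rewrite big_nat_recr//=.
rewrite (le_trans (nrm_triangle (Lu m) (Lu (m + N)) (Lu (m + N.+1))))//.
by rewrite lerD// nrmBC// addnS.
Qed.

Let ndS x : nondecreasing_seq (S ^~ x).
Proof.
apply/nondecreasing_seqP => n; rewrite /S [leRHS]big_nat_recr//=.
by rewrite lerDl.
Qed.

(** Squares are used because [S_L2] bounds their integrals uniformly; monotone convergence then
    makes the limit integrable, hence finite almost everywhere. *)
Let good := [set x : E | (limn (fun N => (S N x ^+ 2)%:E) < +oo)%E].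

Let mS N : measurable_fun setT (fun x => (S N x ^+ 2)%:E).
Proof.
apply/measurable_EFinP; apply: measurable_funX.
by have [[[+ _] _] _] := S_L2 N.
Qed.

Let ndS2 x : nondecreasing_seq (fun N => (S N x ^+ 2)%:E).
Proof.
move=> n m nm; rewrite lee_fin lerXn2r ?nnegrE ?sumr_ge0//.
exact: ndS.
Qed.

Let mlim : measurable_fun setT (fun x => limn (fun N => (S N x ^+ 2)%:E)).
Proof.
apply: (@emeasurable_fun_cvg _ _ _ _ (fun N x => (S N x ^+ 2)%:E)) => // x _.
exact: ereal_nondecreasing_is_cvgn.
Qed.

Let mgood : measurable good.
Proof.
have := emeasurable_fun_infty_o measurableT mlim +oo%E.
by rewrite setTI.
Qed.

Let ae_good : {ae mu, forall x, good x}.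
Proof.
have i : mu.-integrable setT (fun x => limn (fun N => (S N x ^+ 2)%:E)).
  apply/integrableP; split => //.
  rewrite (eq_integral (fun x => limn (fun N => (S N x ^+ 2)%:E))); last first.
    move=> x _; rewrite gee0_abs// lime_ge//.
      exact: ereal_nondecreasing_is_cvgn.
    by apply: nearW => n; rewrite lee_fin sqr_ge0.
  have S20 n x : setT x -> (0 <= (S n x ^+ 2)%:E)%E by move=> _; rewrite lee_fin sqr_ge0.
  rewrite (monotone_convergence _ measurableT mS S20 (fun x _ => ndS2 x)).
  apply: (@le_lt_trans _ _ ((2 * c) ^+ 2)%:E); last exact: ltry.
  apply: lime_le.
    apply: ereal_nondecreasing_is_cvgn => n m nm; apply: ge0_le_integral => //.
    - by move=> x _; rewrite lee_fin sqr_ge0.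
    - by move=> x _; exact: ndS2.
  apply: nearW => n.
  have [LS leS] := S_L2 n.
  have -> : (\int[mu]_x (S n x ^+ 2)%:E)%E = sqint (fun x => (S n x)%:C).
    by apply: eq_integral => x _; rewrite normc2E/= expr0n addr0.
  rewrite (sqint_nrm LS) lee_fin lerXn2r ?nnegrE ?nrm_ge0 ?mulr_ge0//.
  rewrite (le_trans leS)//.
  by have := half_sum 0 n; rewrite expr0 mulr1.
apply: filterS (integrable_ae measurableT i) => x /(_ I).
by rewrite /good/= => /fin_numPlt/andP[].
Qed.

Let good_bounded x : good x -> exists M, forall N, S N x <= M.
Proof.
move=> gx; have cv := ereal_nondecreasing_cvgn (@ndS2 x).
have le N : ((S N x ^+ 2)%:E <= limn (fun N => (S N x ^+ 2)%:E))%E.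
  by rewrite (cvg_lim _ cv)//; apply: ereal_sup_ubound; exists N.
have fl : limn (fun N => (S N x ^+ 2)%:E) \is a fin_num.
  by rewrite ge0_fin_numE//; apply: le_trans (le 0%N); rewrite lee_fin sqr_ge0.
(* A bound [l] on [S^2] gives [S <= l + 1], since [S <= S^2 + 1]. *)
exists (fine (limn (fun N => (S N x ^+ 2)%:E)) + 1) => N.
have := le N; rewrite -(fineK fl) lee_fin => leN.
by rewrite (le_trans _ (lerD leN (lexx 1)))//; nra.
Qed.

Let good_cvg x (a : nat -> R) : good x ->
  (forall n, `|a n.+1 - a n| <= D n x) -> cvgn a.
Proof.
move=> /good_bounded[M SM] aD.
have cs : cvgn (series (telescope a)).
  apply: (@normed_cvg R R^o); apply: nondecreasing_is_cvgn.
    apply/nondecreasing_seqP => n; rewrite [leRHS]seriesSr lerDl; exact: normr_ge0.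
  exists M => _ [n _ <-]; apply: le_trans (SM n).
  by apply: ler_sum => k _; exact: aD.
have -> : a = (fun n => series (telescope a) n + a 0%N).
  by rewrite telescopeK; apply/funext => n /=; rewrite subrK.
by apply: is_cvgD => //; exact: is_cvg_cst.
Qed.

Lemma ler_Re_normc (z : R[i]) : `|complex.Re z| <= normc z.
Proof.
by case: z => a b /=; rewrite -sqrtr_sqr ler_wsqrtr// lerDl sqr_ge0.
Qed.

Lemma ler_Im_normc (z : R[i]) : `|complex.Im z| <= normc z.
Proof.
by case: z => a b /=; rewrite -sqrtr_sqr ler_wsqrtr// lerDr sqr_ge0.
Qed.

(** Setting the sequence to zero on the exceptional null set makes it converge at every point, so
    the limit [w] is measurable as an everywhere pointwise limit. *)
Let v n x : R[i] := (\1_good x)%:C * u n x.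

Let indic_c : cmeasurable (fun x => (\1_good x)%:C : R[i]).
Proof. by split => /=; [exact: measurable_indic|exact: measurable_cst]. Qed.

Let indic_le x : normc ((\1_good x)%:C : R[i]) <= 1.
Proof.
rewrite /= expr0n/= addr0 sqrtr_sqr indicE; case: (_ \in _) => /=.
  by rewrite normr1.
by rewrite normr0.
Qed.

Let Lv n : L2 (v n).
Proof. by have [] := L2_mul ler01 indic_c indic_le (Lu n). Qed.

Let v_bad n x : ~ good x -> v n x = 0.
Proof. by move=> bx; rewrite /v indicE memNset// mul0r. Qed.

Let v_good n x : good x -> v n x = u n x.
Proof. by move=> gx; rewrite /v indicE mem_set// mul1r. Qed.

Let Re_cvg x : cvgn (fun n => complex.Re (v n x)).
Proof.
have [gx|bx] := pselect (good x).
  apply: (good_cvg gx) => n; rewrite !v_good// /D.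
  apply: le_trans (ler_Re_normc _); rewrite le_eqVlt; apply/orP; left; apply/eqP.
  by case: (u n.+1 x) (u n x) => ? ? [].
under eq_fun do rewrite v_bad//.
exact: is_cvg_cst.
Qed.

Let Im_cvg x : cvgn (fun n => complex.Im (v n x)).
Proof.
have [gx|bx] := pselect (good x).
  apply: (good_cvg gx) => n; rewrite !v_good// /D.
  apply: le_trans (ler_Im_normc _); rewrite le_eqVlt; apply/orP; left; apply/eqP.
  by case: (u n.+1 x) (u n x) => ? ? [].
under eq_fun do rewrite v_bad//.
exact: is_cvg_cst.
Qed.

Let w x : R[i] := limn (fun n => complex.Re (v n x)) +i* limn (fun n => complex.Im (v n x)).

Let mw : cmeasurable w.
Proof.
split => /=.
  apply: (@measurable_fun_cvg _ _ _ setT (fun n x => complex.Re (v n x))) => [n|x _].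
    by have [[]] := Lv n.
  exact: Re_cvg.
apply: (@measurable_fun_cvg _ _ _ setT (fun n x => complex.Im (v n x))) => [n|x _].
  by have [[]] := Lv n.
exact: Im_cvg.
Qed.

Let v_le m N : (sqint (fun x => v m x - v (m + N)%N x)%R <= ((2 * c * 2^-1 ^+ m) ^+ 2)%:E)%E.
Proof.
rewrite (sqint_nrm (L2B (Lv m) (Lv (m + N)))) lee_fin.
rewrite lerXn2r ?nnegrE ?nrm_ge0 ?mulr_ge0 ?exprn_ge0//.
apply: le_trans (nrm_tail m N).
apply: (nrm_le (L2B (Lv _) (Lv _)) (L2B (Lu _) (Lu _))) => x.
rewrite /v -mulrBr ComplexField.Normc.normcM ler_piMl ?normc_ge0//.
Qed.

Let cvg_subX2 (a : nat -> R) (r l : R) : a n @[n --> \oo] --> l ->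
  (r - a n) ^+ 2 @[n --> \oo] --> (r - l) ^+ 2.
Proof.
move=> al; have h : r - a n @[n --> \oo] --> r - l by apply: cvgB => //; exact: cvg_cst.
by rewrite expr2; under eq_fun do rewrite expr2; exact: cvgM.
Qed.

Let vw_cvg m x : (normc (v m x - v (m + N)%N x) ^+ 2)%:E @[N --> \oo] -->
  (normc (v m x - w x) ^+ 2)%:E.
Proof.
suff : normc (v m x - v (m + N)%N x) ^+ 2 @[N --> \oo] --> normc (v m x - w x) ^+ 2.
  by move=> H; apply: cvg_EFin => //; exact: nearW.
rewrite normc2E.
have -> : (fun N => normc (v m x - v (m + N)%N x) ^+ 2) =
    (fun N => (complex.Re (v m x) - complex.Re (v (N + m)%N x)) ^+ 2 +
              (complex.Im (v m x) - complex.Im (v (N + m)%N x)) ^+ 2).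
  apply/funext => N; rewrite normc2E addnC.
  by case: (v m x) (v (N + m)%N x) => ? ? [].
have -> : complex.Re (v m x - w x) = complex.Re (v m x) - complex.Re (w x).
  by case: (v m x) (w x) => ? ? [].
have -> : complex.Im (v m x - w x) = complex.Im (v m x) - complex.Im (w x).
  by case: (v m x) (w x) => ? ? [].
have cr : complex.Re (v (N + m)%N x) @[N --> \oo] --> complex.Re (w x).
  have := @Re_cvg x; rewrite -(cvg_shiftn m); exact.
have ci : complex.Im (v (N + m)%N x) @[N --> \oo] --> complex.Im (w x).
  have := @Im_cvg x; rewrite -(cvg_shiftn m); exact.
by apply: cvgD; exact: cvg_subX2.
Qed.

(** Fatou's lemma applied to the uniform bound [v_le] as [N] tends to infinity. *)
Let sqint_vw m : (sqint (fun x => v m x - w x)%R <= ((2 * c * 2^-1 ^+ m) ^+ 2)%:E)%E.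
Proof.
pose f N x := (normc (v m x - v (m + N)%N x) ^+ 2)%:E.
have mf N : measurable_fun setT (f N).
  exact: measurable_normc2 (L2B (Lv m) (Lv (m + N))).1.
have f0 N x : setT x -> (0 <= f N x)%E by move=> _; rewrite lee_fin sqr_ge0.
have := fatou mu measurableT mf f0.
have -> : (\int[mu]_x limn_einf (f^~ x))%E = sqint (fun x => v m x - w x).
  apply: eq_integral => x _.
  by have [-> _] := cvg_limn_einf_sup (@vw_cvg m x).
move/le_trans; apply; rewrite limn_einf_lim; apply: lime_le.
  exact: is_cvg_einfs.
apply: nearW => n; apply: le_trans (v_le m n).
by apply: ereal_inf_lbound; exists n => /=.
Qed.

Lemma riesz_fischer :
  exists2 w, L2 w & forall m, nrm (fun x => u m x - w x) <= 2 * c * 2^-1 ^+ m.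
Proof.
have b0 m : 0 <= 2 * c * 2^-1 ^+ m by rewrite !mulr_ge0// exprn_ge0.
have H m := sqint_le_L2 (b0 m) (cmeasurableB (Lv m).1 mw) (sqint_vw m).
have Lw : L2 w.
  have [H0 _] := H 0; have := L2B (Lv 0) H0; congr L2.
  by apply/funext => x; rewrite subKr.
exists w => // m; rewrite (le_trans _ (H m).2)// le_eqVlt; apply/orP; left.
rewrite /nrm (L2norm_ae_eq (g := fun x => v m x - w x))//.
- exact: (L2B (Lu m) Lw).1.
- exact: (L2B (Lv m) Lw).1.
by apply: filterS ae_good => x gx; rewrite v_good.
Qed.

End riesz_fischer.

(** * Closures of graphs and bounded perturbations *)

Section operators.
Context {R : realType} {d : nat}.
Local Notation E := 'rV[R]_d.
Local Notation mu := (lebesgue_rV R d).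
Local Notation normc := (@ComplexField.Normc.normc R).
Implicit Types (u v f g : E -> R[i]) (A : operator R d) (p q : (E -> R[i]) * (E -> R[i])).

Lemma ReB (a b : R[i]) : complex.Re (a - b) = complex.Re a - complex.Re b.
Proof. by case: a b => ? ? []. Qed.

Lemma ImB (a b : R[i]) : complex.Im (a - b) = complex.Im a - complex.Im b.
Proof. by case: a b => ? ? []. Qed.

Lemma partialsB u v s : smooth u -> smooth v ->
  partials s (fun x => u x - v x) = (fun x => partials s u x - partials s v x).
Proof.
move=> su sv; elim: s => [//|i s IH] /=; rewrite -/(partials s _) IH.
have [_ _ /(_ i) du] := su s; have [_ _ /(_ i) dv] := sv s.
apply/funext => x; have [dur dui] := du x; have [dvr dvi] := dv x.
have EB (a b a' b' : R) : (a +i* b) - (a' +i* b') = (a - a') +i* (b - b') by [].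
rewrite /partial EB; congr (_ +i* _).
  by under eq_fun do rewrite ReB; exact: (deriveB dur dvr).
by under eq_fun do rewrite ImB; exact: (deriveB dui dvi).
Qed.

Lemma smoothB u v : smooth u -> smooth v -> smooth (fun x => u x - v x).
Proof.
move=> su sv s; rewrite (partialsB s su sv).
have [cur cui du] := su s; have [cvr cvi dv] := sv s.
split.
- under eq_fun do rewrite ReB.
  by apply: fcontinuousD => //; exact: fcontinuousN.
- under eq_fun do rewrite ImB.
  by apply: fcontinuousD => //; exact: fcontinuousN.
- move=> i x; have [dur dui] := du i x; have [dvr dvi] := dv i x; split.
    by under eq_fun do rewrite ReB; exact: derivableB.
  by under eq_fun do rewrite ImB; exact: derivableB.
Qed.

Lemma laplacianB u v x : smooth u -> smooth v ->
  laplacian (fun x => u x - v x) x = laplacian u x - laplacian v x.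
Proof.
move=> su sv; rewrite /laplacian -sumrB; apply: eq_bigr => i _.
exact: (congr1 (fun g => g x) (partialsB [:: i; i] su sv)).
Qed.

Lemma driftB u v x : smooth u -> smooth v ->
  drift (fun x => u x - v x) x = drift u x - drift v x.
Proof.
move=> su sv; rewrite /drift -sumrB; apply: eq_bigr => i _.
rewrite -mulrBr; congr (_ * _).
exact: (congr1 (fun g => g x) (partialsB [:: i] su sv)).
Qed.

Lemma ou_exprB u v : smooth u -> smooth v ->
  ou_expr (fun x => u x - v x) = (fun x => ou_expr u x - ou_expr v x).
Proof.
move=> su sv; apply/funext => x; rewrite /ou_expr laplacianB// driftB//.
move: (laplacian u x) (laplacian v x) (drift u x) (drift v x) => a b a' b'.
by ring.
Qed.

(** Replaces sequences by approximation within any [e], so that later arguments about closures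
    choose one approximant; the converse picks one for each [1 / (n + 1)]. *)
Lemma op_closureP A p : (forall a, A a -> L2 a.1 /\ L2 a.2) ->
  op_closure A p <->
  [/\ L2 p.1, L2 p.2 & forall e, 0 < e -> exists2 a, A a &
    nrm (fun x => a.1 x - p.1 x) <= e /\ nrm (fun x => a.2 x - p.2 x) <= e].
Proof.
move=> AL; split=> [[L1 L2' [u [v [Auv cu cv]]]]|[L1 L2' H]].
  split => // e e0.
  have near0 (f : nat -> E -> R[i]) (g : E -> R[i]) : (forall n, L2 (f n)) -> L2 g ->
      L2norm (fun x => f n x - g x) @[n --> \oo] --> 0%E ->
      \forall n \near \oo, nrm (fun x => f n x - g x) <= e.
    move=> Lf Lg /fine_cvgP[_] /cvgrPdist_le /(_ e e0).
    apply: filterS => n; rewrite sub0r normrN => /(le_trans _); apply.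
    exact: ler_norm.
  have nu := near0 u p.1 (fun n => (AL _ (Auv n)).1) L1 cu.
  have nv := near0 v p.2 (fun n => (AL _ (Auv n)).2) L2' cv.
  have [n [? ?]] := filter_ex (filterI nu nv).
  by exists (u n, v n).
split => //.
have /choice[a aP] : forall n, exists a, A a /\
    nrm (fun x => a.1 x - p.1 x) <= n.+1%:R^-1 /\ nrm (fun x => a.2 x - p.2 x) <= n.+1%:R^-1.
  by move=> n; have [|a Aa Ha] := H n.+1%:R^-1; [rewrite invr_gt0|exists a].
exists (fun n => (a n).1), (fun n => (a n).2).
have cv0 (f : nat -> E -> R[i]) g : (forall n, L2 (f n)) -> L2 g ->
    (forall n, nrm (fun x => f n x - g x) <= n.+1%:R^-1) ->
    L2norm (fun x => f n x - g x) @[n --> \oo] --> 0%E.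
  move=> Lf Lg le.
  rewrite (_ : (fun n => L2norm _) = (fun n => (nrm (fun x => f n x - g x))%:E)); last first.
    by apply/funext => n; rewrite L2normK//; exact: L2B.
  apply: cvg_EFin; first exact: nearW.
  apply: (@squeeze_cvgr _ _ _ _ (fun=> 0) (@harmonic R)).
  - by apply: nearW => n; rewrite /= nrm_ge0 le.
  - exact: cvg_cst.
  - exact: cvg_harmonic.
split.
- by move=> n; have [+ _] := aP n; rewrite -surjective_pairing.
- by apply: cv0 => // n; [have [/AL[]] := aP n|have [_ []] := aP n].
- by apply: cv0 => // n; [have [/AL[]] := aP n|have [_ []] := aP n].
Qed.

(* Drops the [H^2] condition of [pre_L0], which makes linearity immediate while
   keeping the energy estimate. *)
Definition smooth_graph : operator R d :=
  [set p | [/\ smooth p.1, L2 p.1, L2 p.2 & p.2 = ou_expr p.1]].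

Lemma smooth_graph_L2 a : smooth_graph a -> L2 a.1 /\ L2 a.2.
Proof. by case. Qed.

Lemma smooth_graphB a a' : smooth_graph a -> smooth_graph a' ->
  smooth_graph (fun x => a.1 x - a'.1 x, fun x => a.2 x - a'.2 x).
Proof.
move=> [sa La1 La2 ea] [sa' La1' La2' ea']; split => /=.
- exact: smoothB.
- exact: L2B.
- exact: L2B.
- by rewrite ou_exprB// ea ea'.
Qed.

Lemma nrm_near f g : L2 f -> L2 g ->
  nrm f <= nrm g + nrm (fun x => g x - f x).
Proof.
move=> Lf Lg; rewrite [leLHS](_ : _ = nrm (fun x => g x - (g x - f x))).
  by apply: nrmB => //; exact: L2B.
by congr nrm; apply/funext => x; rewrite subKr.
Qed.

(** Makes the estimates on the closure applicable to differences, as the fixed-point argument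
    requires. *)
Lemma closure_smooth_graphB p q : op_closure smooth_graph p ->
  op_closure smooth_graph q ->
  op_closure smooth_graph (fun x => p.1 x - q.1 x, fun x => p.2 x - q.2 x).
Proof.
move=> /(op_closureP _ smooth_graph_L2)[Lp1 Lp2 Hp].
move=> /(op_closureP _ smooth_graph_L2)[Lq1 Lq2 Hq].
apply/(op_closureP _ smooth_graph_L2); split => /=; [exact: L2B|exact: L2B|].
move=> e e0; have e20 : 0 < e / 2 by rewrite divr_gt0.
have [a Aa [a1 a2]] := Hp _ e20; have [a' Aa' [a1' a2']] := Hq _ e20.
exists (fun x => a.1 x - a'.1 x, fun x => a.2 x - a'.2 x).
  exact: smooth_graphB.
have [La1 La2] := smooth_graph_L2 Aa; have [La1' La2'] := smooth_graph_L2 Aa'.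
have tri (f g f' g' : E -> R[i]) : L2 f -> L2 g -> L2 f' -> L2 g' ->
    nrm (fun x => f x - g x) <= e / 2 -> nrm (fun x => f' x - g' x) <= e / 2 ->
    nrm (fun x => (f x - f' x) - (g x - g' x)) <= e.
  move=> Lf Lg Lf' Lg' h h'.
  rewrite [leLHS](_ : _ = nrm (fun x => (f x - g x) - (f' x - g' x))).
    by rewrite (le_trans (nrmB (L2B Lf Lg) (L2B Lf' Lg')))// [leRHS]splitr lerD.
  by congr nrm; apply/funext => x; ring.
by split; exact: tri.
Qed.

Lemma L2_shifted z p : L2 p.1 -> L2 p.2 -> L2 (shifted z p).
Proof. by move=> L1 L2'; apply: L2B => //; have [] := L2Z z L1. Qed.

Lemma nrm_shifted_near z p q : L2 p.1 -> L2 p.2 -> L2 q.1 -> L2 q.2 ->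
  nrm (shifted z p) <= nrm (shifted z q) +
    (normc z * nrm (fun x => p.1 x - q.1 x) + nrm (fun x => p.2 x - q.2 x)).
Proof.
move=> Lp1 Lp2 Lq1 Lq2.
have := nrm_near (L2_shifted z Lp1 Lp2) (L2_shifted z Lq1 Lq2).
move/le_trans; apply; rewrite lerD2l nrmBC; [|exact: L2_shifted..].
rewrite [leLHS](_ : _ = nrm (fun x => z * (p.1 x - q.1 x) - (p.2 x - q.2 x))); last first.
  by congr nrm; apply/funext => x; rewrite /shifted; ring.
have [LZ leZ] := L2Z z (L2B Lp1 Lq1).
by rewrite (le_trans (nrmB LZ (L2B Lp2 Lq2)))// lerD2r.
Qed.

End operators.

(** * The Neumann series for a bounded multiplication operator *)

Section perturbation.
Context {R : realType} {d : nat}.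
Local Notation E := 'rV[R]_d.
Local Notation normc := (@ComplexField.Normc.normc R).
Implicit Types (p q : (E -> R[i]) * (E -> R[i])).
Variables (A0 : operator R d) (w : E -> R[i]) (B K : R) (z : R[i]).
Hypotheses (B0 : 0 <= B) (mw : cmeasurable w) (wB : forall x, normc (w x) <= B).
Hypothesis K0 : 0 <= K.
Hypothesis AL : forall p, A0 p -> L2 p.1 /\ L2 p.2.
Hypothesis Aclosed : forall u v, L2 u -> L2 v ->
  (forall e, 0 < e -> exists2 p, A0 p &
    nrm (fun x => p.1 x - u x) <= e /\ nrm (fun x => p.2 x - v x) <= e) ->
  A0 (u, v).
Hypothesis Abound : forall p, A0 p ->
  nrm p.1 <= K * nrm (shifted z p) /\
  nrm (fun x => w x * p.1 x) <= 2^-1 * nrm (shifted z p).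
Hypothesis AboundB : forall p q, A0 p -> A0 q ->
  nrm (fun x => p.1 x - q.1 x) <=
    K * nrm (fun x => shifted z p x - shifted z q x) /\
  nrm (fun x => w x * (p.1 x - q.1 x)) <=
    2^-1 * nrm (fun x => shifted z p x - shifted z q x).

(** A pair [p] is in the graph of [A0 + w] exactly when [unperturbed p] is in that of [A0]. *)
Let unperturbed p := (p.1, fun x => p.2 x - w x * p.1 x).

Let Lw f : L2 f -> L2 (fun x => w x * f x).
Proof. by move=> Lf; have [] := L2_mul B0 mw wB Lf. Qed.

Let nw f : L2 f -> nrm (fun x => w x * f x) <= B * nrm f.
Proof. by move=> Lf; have [] := L2_mul B0 mw wB Lf. Qed.

Let nrm_ae (f g : E -> R[i]) : L2 f -> L2 g -> ae_equal f g -> nrm f = nrm g.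
Proof. by move=> Lf Lg fg; rewrite /nrm (L2norm_ae_eq Lf.1 Lg.1 fg). Qed.

Let L2_of p : A0 (unperturbed p) -> L2 p.1 /\ L2 p.2.
Proof.
move=> /AL[/= L1 L2']; split => //.
rewrite (_ : p.2 = fun x => (p.2 x - w x * p.1 x) + w x * p.1 x).
  by apply: L2D => //; exact: Lw.
by apply/funext => x; rewrite subrK.
Qed.

(** The images under [z - A0] differ almost everywhere by [w (p - q)], whose norm is at most half of
    that same difference, so the difference is zero. *)
Let uniqueness p q : A0 (unperturbed p) -> A0 (unperturbed q) ->
  ae_equal (shifted z p) (shifted z q) -> ae_equal p.1 q.1.
Proof.
move=> Ap Aq spq; have [Lp1 Lp2] := L2_of Ap; have [Lq1 Lq2] := L2_of Aq.
have := AboundB Ap Aq; rewrite /=.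
set dlt := nrm (fun x => shifted z (unperturbed p) x - _).
move=> [le1 le2].
have dle : dlt <= nrm (fun x => w x * (p.1 x - q.1 x)).
  have -> : dlt = nrm (fun x => (shifted z p x - shifted z q x) + w x * (p.1 x - q.1 x)).
    by congr nrm; apply/funext => x; rewrite /shifted/=; ring.
  have Ls := L2B (L2_shifted z Lp1 Lp2) (L2_shifted z Lq1 Lq2).
  rewrite (le_trans (nrmD Ls (Lw (L2B Lp1 Lq1))))// gerDr le_eqVlt; apply/orP; left.
  have [L0 n0] := L2Z 0 Lp1; rewrite ComplexField.Normc.normc0 mul0r in n0.
  rewrite (nrm_ae Ls L0); last first.
    by apply: filterS spq => x ->; rewrite subrr mul0r.
  by rewrite eq_le n0 nrm_ge0.
have d0 : dlt <= 0.
  by have := le_trans dle le2; lra.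
apply: nrm_eq0 => //; apply/eqP; rewrite eq_le nrm_ge0 andbT (le_trans le1)//.
exact: mulr_ge0_le0.
Qed.

(** Since [(z - A0) u = (z - A0 - w) u + w u] and the last term has at most half the norm of the
    left-hand side, it is absorbed; this doubles [K]. *)
Let bound p : A0 (unperturbed p) ->
  (L2norm p.1 <= (2 * K)%:E * L2norm (shifted z p))%E.
Proof.
move=> Ap; have [Lp1 Lp2] := L2_of Ap.
have Ls := L2_shifted z Lp1 Lp2.
rewrite (L2normK Lp1) (L2normK Ls) -EFinM lee_fin.
have [le1 le2] := Abound Ap.
have les : nrm (shifted z (unperturbed p)) <= nrm (shifted z p) + nrm (fun x => w x * p.1 x).
  rewrite [leLHS](_ : _ = nrm (fun x => shifted z p x + w x * p.1 x)).
    exact: nrmD Ls (Lw Lp1).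
  by congr nrm; apply/funext => x; rewrite /shifted/=; ring.
have : nrm (shifted z (unperturbed p)) <= 2 * nrm (shifted z p) by move: le2 => /=; lra.
by move/(ler_wpM2l K0); move: le1 => /=; rewrite [2 * K]mulrC -mulrA; exact: le_trans.
Qed.

Hypothesis solvable : forall g, L2 g -> exists2 p, A0 p & ae_equal (shifted z p) g.

(* The fixed point of [u |-> (z - A0)^-1 (h + w u)] is reached by iteration: only
   differences of elements of [A0] are estimated, so [A0] need not be linear. *)
Let existence h : L2 h ->
  exists2 p, A0 (unperturbed p) & ae_equal (shifted z p) h.
Proof.
move=> Lh.
have /choice[S HS] : forall g, exists p, L2 g -> A0 p /\ ae_equal (shifted z p) g.
  move=> g; have [/solvable[p Ap pg]|?] := pselect (L2 g); first by exists p.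
  (* A placeholder outside [L2]. *)
  by exists (g, g).
pose P := fix P n := if n is m.+1 then S (fun x => h x + w x * (P m).1 x) else S h.
pose g n := if n is m.+1 then (fun x => h x + w x * (P m).1 x) else h.
have PE n : P n = S (g n) by case: n.
have Lg n : L2 (g n).
  elim: n => [//|n IH] /=; apply: L2D => //; apply: Lw; rewrite PE.
  by have [/AL[]] := HS _ IH.
have AP n : A0 (P n) by rewrite PE; have [] := HS _ (Lg n).
have gP n : ae_equal (shifted z (P n)) (g n) by rewrite PE; have [] := HS _ (Lg n).
have LP1 n : L2 (P n).1 by have [] := AL (AP n).
have LP2 n : L2 (P n).2 by have [] := AL (AP n).
have LsP n : L2 (shifted z (P n)) by exact: L2_shifted.
pose a n := nrm (fun x => g n.+1 x - g n x).
have sE n : nrm (fun x => shifted z (P n.+1) x - shifted z (P n) x) = a n.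
  apply: nrm_ae; [exact: L2B|exact: L2B|].
  by apply: filterS2 (gP n.+1) (gP n) => x -> ->.
have aS n : a n.+1 <= 2^-1 * a n.
  rewrite -(sE n); have [_ H] := AboundB (AP n.+1) (AP n); rewrite (le_trans _ H)//.
  rewrite le_eqVlt; apply/orP; left; apply/eqP; congr nrm; apply/funext => x /=.
  by ring.
have aE n : a n <= a 0%N * 2^-1 ^+ n.
  elim: n => [|n IH]; first by rewrite expr0 mulr1.
  rewrite (le_trans (aS n))// exprS mulrCA ler_wpM2l//.
have uc n : nrm (fun x => (P n.+1).1 x - (P n).1 x) <= (K * a 0%N) * 2^-1 ^+ n.
  have [+ _] := AboundB (AP n.+1) (AP n); rewrite sE => /le_trans; apply.
  by rewrite -mulrA ler_wpM2l.
have [u Lu Pu] := riesz_fischer LP1 uc.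
(* The value that [A0 u] must take for [u] to solve the perturbed equation; closedness of [A0] is
   what puts [(u, v)] in the graph. *)
pose v x := z * u x - h x - w x * u x.
have Lv : L2 v.
  by apply: L2B; [apply: L2B => //; have [] := L2Z z Lu|exact: Lw].
set c := 2 * (K * a 0%N) in Pu.
have c0 : 0 <= c by rewrite /c !mulr_ge0// nrm_ge0.
have Auv : A0 (u, v).
  apply: Aclosed => // e e0.
  have z0 := normc_ge0 z.
  (* This factor dominates both [1], for the first components, and [normc z + B], for the second
     ones. *)
  have k0 : 0 < normc z + B + 1 by rewrite ltr_wpDl// addr_ge0.
  have [m me] : exists m, (normc z + B + 1) * (c * 2^-1 ^+ m) <= e.
    have : geometric ((normc z + B + 1) * c) 2^-1 @ \oo --> (0 : R).
      by apply: cvg_geometric; rewrite ger0_norm// invf_lt1// ltr1n.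
    move=> /cvgrPdist_le/(_ e e0)[m _ /(_ m (leqnn m))] /=.
    rewrite sub0r normrN => /(le_trans (ler_norm _)) H.
    by exists m; rewrite mulrA.
  have t0 : 0 <= c * 2^-1 ^+ m by rewrite mulr_ge0// exprn_ge0.
  have Pm1 : nrm (fun x => (P m.+1).1 x - u x) <= c * 2^-1 ^+ m.
    rewrite (le_trans (Pu m.+1))// ler_wpM2l// exprS ler_piMl ?exprn_ge0//.
    by rewrite invf_le1// ler1n.
  exists (P m.+1) => //; split.
    by rewrite (le_trans Pm1)// (le_trans _ me)// ler_peMl// lerDr addr_ge0.
  have LPu := L2B (LP1 m.+1) Lu; have LPu' := L2B (LP1 m) Lu.
  have [LZ leZ] := L2Z z LPu.
  (* The iterate satisfies its equation with [w] applied to the previous iterate, hence two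
     consecutive indices; [Pm1] weakens the rate at [m.+1] to that at [m]. *)
  rewrite (nrm_ae (g := fun x => z * ((P m.+1).1 x - u x) - w x * ((P m).1 x - u x))).
  - rewrite (le_trans (nrmB LZ (Lw LPu')))//.
    have := nw LPu'; have := Pu m => h1 h2.
    have := ler_wpM2l z0 Pm1; have := ler_wpM2l B0 h1; lra.
  - exact: L2B.
  - by apply: L2B => //; exact: Lw.
  - apply: filterS (gP m.+1) => x; rewrite /shifted /g /v => H.
    have -> : (P m.+1).2 x = z * (P m.+1).1 x - (h x + w x * (P m).1 x).
      by rewrite -H subKr.
    ring.
exists (u, fun x => v x + w x * u x).
  rewrite /unperturbed/= (_ : (fun x => _) = v)//.
  by apply/funext => x; rewrite addrK.
by apply: aeW => x; rewrite /shifted/v/=; ring.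
Qed.

Lemma perturbed_resolvent :
  resolvent_set [set p | A0 (p.1, fun x => p.2 x - w x * p.1 x)] z.
Proof.
split.
- by move=> p q; exact: uniqueness.
- by move=> h /existence.
- by exists (2 * K) => p; exact: bound.
Qed.

End perturbation.

(** * Estimates for the free operator at [z = d + b + i omega] *)

Section spectrum.
Context {R : realType} {d : nat}.
Local Notation E := 'rV[R]_d.
Local Notation mu := (lebesgue_rV R d).
Local Notation normc := (@ComplexField.Normc.normc R).
Implicit Types (a p q : (E -> R[i]) * (E -> R[i])).

Section estimates.
Variables (b omega c : R) (w : E -> R[i]).
Hypotheses (b0 : 0 < b) (c0 : 0 <= c) (mw : cmeasurable w).
Hypothesis wc : forall x, normc (w x) ^+ 2 <= c * inv_japanese2 x.
Let K := (4 + 5 / b) / b + 1.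
Let z := (d%:R + b) +i* omega.
Hypotheses (omega0 : 0 < `|omega|) (omega_large : 4 * (c * K) <= `|omega|).

Let K0 : 0 <= K.
Proof. by rewrite /K addr_ge0// divr_ge0 ?addr_ge0 ?divr_ge0// ltW. Qed.

Lemma inv_japanese2_le1 (x : E) : inv_japanese2 x <= 1.
Proof.
by rewrite /inv_japanese2 invf_le1 ?lerDl ?sqnorm_ge0// ltr_wpDr// sqnorm_ge0.
Qed.

Let wB x : normc (w x) <= Num.sqrt c.
Proof.
rewrite -(ger0_norm (normc_ge0 _)) -sqrtr_sqr ler_wsqrtr// (le_trans (wc x))//.
by rewrite ler_piMr// inv_japanese2_le1.
Qed.

(** Both bounds weaken the energy estimate pointwise. The first drops the [omega] term. The second
    uses [|w|^2 <= (c / |omega|) (1 + |omega| / (1 + |x|^2))], so the squared norm of [w u] is at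
    most [c K / |omega|], hence a quarter, of that of [(z - L_0) u]: [omega_large] is the condition
    for the factor [1 / 2]. *)
Lemma smooth_graph_estimate p : smooth_graph p ->
  nrm p.1 <= Num.sqrt K * nrm (shifted z p) /\
  nrm (fun x => w x * p.1 x) <= 2^-1 * nrm (shifted z p).
Proof.
move: p => [u v] [/= su Lu Lv ev].
have Lf : L2 (shifted z (u, v)) by exact: L2_shifted.
have := @energy_estimate R d u su b omega b0 (integrable_normc2 Lu).
rewrite -ev => /(_ (integrable_normc2 Lf)).
rewrite -/K -/z -[X in (_ <= _ * X)%E]/(sqint _) (sqint_nrm Lf) -EFinM.
set I := (X in (X <= _)%E) => H.
have mu2 : measurable_fun setT (fun x => normc (u x) ^+ 2).
  by apply/measurable_EFinP; exact: measurable_normc2 Lu.1.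
have mh : measurable_fun setT (fun x =>
    (normc (u x) ^+ 2 * (1 + `|omega| * inv_japanese2 x))%:E).
  apply/measurable_EFinP; apply: measurable_funM => //.
  apply: continuous_measurable_rV; apply: fcontinuousD; first exact: fcontinuous_cst.
  by apply: fcontinuousM; [exact: fcontinuous_cst|exact: continuous_inv_japanese2].
have h0 x : 0 <= normc (u x) ^+ 2 * (1 + `|omega| * inv_japanese2 x).
  by rewrite mulr_ge0 ?sqr_ge0// addr_ge0// mulr_ge0// inv_japanese2_ge0.
split.
  apply: (proj2 (sqint_le_L2 _ Lu.1 _)).
    by rewrite mulr_ge0 ?sqrtr_ge0 ?nrm_ge0.
  rewrite exprMn sqr_sqrtr//; apply: le_trans H.
  apply: ge0_le_integral => //.
  - by move=> x _; rewrite lee_fin sqr_ge0.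
  - exact: measurable_normc2 Lu.1.
  - move=> x _; rewrite lee_fin ler_peMr ?sqr_ge0// lerDl mulr_ge0//.
    exact: inv_japanese2_ge0.
apply: (proj2 (sqint_le_L2 _ (cmeasurableM mw Lu.1) _)).
  by rewrite mulr_ge0 ?invr_ge0 ?nrm_ge0.
have : ((c / `|omega|)%:E * I <= (c / `|omega|)%:E * (K * nrm (shifted z (u, v)) ^+ 2)%:E)%E.
  by apply: lee_wpmul2l => //; rewrite lee_fin divr_ge0.
move=> H'; apply: le_trans (le_trans _ H') _.
  rewrite /I -ge0_integralZl//; first last.
  - by rewrite lee_fin divr_ge0.
  - by move=> x _; rewrite lee_fin.
  apply: ge0_le_integral => //.
  - by move=> x _; rewrite lee_fin sqr_ge0.
  - exact: (measurable_normc2 (cmeasurableM mw Lu.1)).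
  - exact: measurable_funeM.
  - move=> x _; rewrite -EFinM lee_fin ComplexField.Normc.normcM exprMn.
    rewrite (@le_trans _ _ (c * inv_japanese2 x * normc (u x) ^+ 2))//.
      by rewrite ler_wpM2r// sqr_ge0.
    have -> : c / `|omega| * (normc (u x) ^+ 2 * (1 + `|omega| * inv_japanese2 x)) =
        (c / `|omega| + c * inv_japanese2 x) * normc (u x) ^+ 2.
      by field; rewrite gt_eqF.
    by rewrite ler_wpM2r ?sqr_ge0// lerDr divr_ge0.
rewrite -EFinM lee_fin exprMn mulrA ler_wpM2r ?sqr_ge0//.
rewrite mulrAC ler_pdivrMr// expr2 -invfM -ler_pdivrMl ?invr_gt0// invrK.
by apply: le_trans omega_large; lra.
Qed.

Lemma closure_estimate p : op_closure smooth_graph p ->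
  nrm p.1 <= Num.sqrt K * nrm (shifted z p) /\
  nrm (fun x => w x * p.1 x) <= 2^-1 * nrm (shifted z p).
Proof.
move=> /(op_closureP _ smooth_graph_L2)[Lp1 Lp2 Hp].
have s0 : 0 <= Num.sqrt c := sqrtr_ge0 _.
have k0 : 0 <= Num.sqrt K := sqrtr_ge0 _.
have z0 := normc_ge0 z.
(* Each inequality holds for an approximant up to an error proportional to [e]; this lets [e] tend
   to zero. *)
have limit (k x y : R) : 0 <= k -> (forall e, 0 < e -> x <= y + e * k) -> x <= y.
  move=> k_ge0 H; apply/ler_addgt0Pr => e e0.
  have k1 : 0 < k + 1 by rewrite ltr_wpDl.
  apply: le_trans (H (e / (k + 1)) (divr_gt0 e0 k1)) _.
  by rewrite lerD2l mulrAC ler_pdivrMr// ler_wpM2l ?lerDl// ltW.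
have approx e : 0 < e -> exists2 a, smooth_graph a &
    [/\ nrm (fun x => a.1 x - p.1 x) <= e,
        nrm (shifted z a) <= nrm (shifted z p) + e * (normc z + 1) & L2 a.1].
  move=> e0; have [a Aa [a1 a2]] := Hp e e0; exists a => //.
  have [La1 La2] := smooth_graph_L2 Aa; split => //.
  apply: le_trans (nrm_shifted_near z La1 La2 Lp1 Lp2) _.
  rewrite lerD2l mulrDr mulr1 mulrC lerD// ler_wpM2r//.
split.
  apply: (limit (Num.sqrt K * (normc z + 1) + 1)).
    by rewrite addr_ge0// mulr_ge0// addr_ge0.
  move=> e e0; have [a Aa [a1 a2 La]] := approx e e0.
  have [h _] := smooth_graph_estimate Aa.
  have := nrm_near Lp1 La; have := ler_wpM2l k0 a2; lra.
apply: (limit (2^-1 * (normc z + 1) + Num.sqrt c)).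
  by rewrite addr_ge0// mulr_ge0// addr_ge0.
move=> e e0; have [a Aa [a1 a2 La]] := approx e e0.
have [_ h] := smooth_graph_estimate Aa.
have [Lwp _] := L2_mul s0 mw wB Lp1; have [Lwa _] := L2_mul s0 mw wB La.
have := nrm_near Lwp Lwa.
rewrite (_ : (fun x => w x * a.1 x - w x * p.1 x) = (fun x => w x * (a.1 x - p.1 x))); last first.
  by apply/funext => x; rewrite mulrBr.
have [_ le] := L2_mul s0 mw wB (L2B La Lp1).
by have := ler_wpM2l s0 a1; lra.
Qed.

End estimates.

(** * The potential as a bounded multiplication operator *)

Section potential.
Variables (V V' : R -> R[i]) (C : R).
Hypothesis hC : 0 < C.
Hypothesis hV' : forall r : R, 0 <= r -> halfline_derivative V r (V' r).
Hypothesis hV : forall r : R, 0 <= r -> normc (V r) <= C * japanese r ^- 2.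

Let w (x : E) : R[i] := V (enorm x).

Lemma enorm_ge0 (x : E) : 0 <= enorm x.
Proof. exact: sqrtr_ge0. Qed.

Let wE x : normc (w x) <= C * inv_japanese2 x.
Proof.
rewrite (le_trans (hV (enorm_ge0 x)))// /japanese /inv_japanese2 sqr_sqrtr.
  by rewrite /enorm sqr_sqrtr// sqnorm_ge0.
by rewrite addr_ge0// sqr_ge0.
Qed.

Let wB x : normc (w x) <= C.
Proof.
by rewrite (le_trans (wE x))// ler_piMr ?(ltW hC)// inv_japanese2_le1.
Qed.

Let wc x : normc (w x) ^+ 2 <= C ^+ 2 * inv_japanese2 x.
Proof.
rewrite (@le_trans _ _ ((C * inv_japanese2 x) ^+ 2))//.
  by rewrite lerXn2r ?nnegrE ?normc_ge0 ?mulr_ge0 ?inv_japanese2_ge0// ltW.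
rewrite exprMn ler_wpM2l ?sqr_ge0// expr2 ler_piMl ?inv_japanese2_ge0//.
exact: inv_japanese2_le1.
Qed.

(** Near [r] the difference quotient stays below [|l r| + 1], a local Lipschitz bound at [r].
    Continuity on the closed half-line is what makes [x |-> V (enorm x)] measurable. *)
Let within_continuous (f : R -> R) (l : R -> R) :
  (forall r, 0 <= r -> (f s - f r) / (s - r)
    @[s --> within [set s | 0 <= s] r^'] --> l r) ->
  {within [set s | 0 <= s], continuous f}.
Proof.
move=> fl; apply/subspace_continuousP => r /= r0.
apply/cvgrPdist_le => e e0.
have H : \forall s \near nbhs r, s != r -> 0 <= s ->
    `|l r - (f s - f r) / (s - r)| <= 1.
  by have := fl r r0 => /cvgrPdist_le /(_ 1 ltr01).
have k0 : 0 < `|l r| + 1 by rewrite ltr_wpDl.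
rewrite near_withinE; near=> s => s0.
have [->|sr] := eqVneq s r; first by rewrite subrr normr0 ltW.
have Hs : `|l r - (f s - f r) / (s - r)| <= 1.
  by have := near H s; apply.
have q : `|(f s - f r) / (s - r)| <= `|l r| + 1.
  rewrite -[X in `|X|](subKr (l r)) (le_trans (ler_normB _ _))// lerD2l//.
have -> : f r - f s = - ((f s - f r) / (s - r) * (s - r)).
  by rewrite divfK ?opprB// subr_eq0.
rewrite normrN normrM.
apply: le_trans (ler_wpM2r (normr_ge0 _) q) _.
rewrite mulrC -ler_pdivlMr// distrC ltW//; near: s.
by apply: (nbhsx_ballx r); rewrite divr_gt0.
Unshelve. all: by end_near. Qed.

Let mw : cmeasurable w.
Proof.
have me : measurable_fun setT (@enorm R d).
  apply: (measurableT_comp (f := @Num.sqrt R) (g := @sqnorm R d)).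
    by apply: continuous_measurable_fun; exact: sqrt_continuous.
  by apply: continuous_measurable_rV; exact: continuous_sqnorm.
have mD : measurable [set s : R | 0 <= s].
  by rewrite -set_itvcy; exact: measurable_itv.
split.
  apply: (measurable_comp (F := [set s : R | 0 <= s]) (f := fun s => complex.Re (V s))) => //.
    by move=> _ [x _ <-]; exact: enorm_ge0.
  apply: subspace_continuous_measurable_fun => //.
  by apply: within_continuous => r r0; have [H _] := hV' r0; exact: H.
apply: (measurable_comp (F := [set s : R | 0 <= s]) (f := fun s => complex.Im (V s))) => //.
  by move=> _ [x _ <-]; exact: enorm_ge0.
apply: subspace_continuous_measurable_fun => //.
by apply: within_continuous => r r0; have [_ H] := hV' r0; exact: H.
Qed.

Let Lw (f : E -> R[i]) : L2 f -> L2 (fun x => w x * f x).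
Proof. by move=> Lf; have [] := L2_mul (ltW hC) mw wB Lf. Qed.

Let pre_L_L2 a : pre_L V a -> L2 a.1 /\ L2 a.2.
Proof. by case=> [[[La _] _ Lo] ->]. Qed.

Let pre_L0_smooth a : pre_L0 V a -> smooth_graph a.
Proof.
case: a => [u v] [/= [[Lu _] su Lo] ->]; split => //=.
rewrite (_ : ou_expr u = fun x => ouV_expr V u x - w x * u x).
  by apply: L2B => //; exact: Lw.
by apply/funext => x; rewrite /ouV_expr addrK.
Qed.

Let pre_L0_L2 a : pre_L0 V a -> L2 a.1 /\ L2 a.2.
Proof. by move=> /pre_L0_smooth/smooth_graph_L2. Qed.

Let OU_L0_smooth p : OU_L0 V p -> op_closure smooth_graph p.
Proof.
move=> /(op_closureP _ pre_L0_L2)[L1 L2' H].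
apply/(op_closureP _ smooth_graph_L2); split => // e /H[a Aa ae].
by exists a => //; exact: pre_L0_smooth.
Qed.

Let OU_L0_L2 p : OU_L0 V p -> L2 p.1 /\ L2 p.2.
Proof. by case. Qed.

Let OU_L0_closed (u v : E -> R[i]) : L2 u -> L2 v ->
  (forall e, 0 < e -> exists2 p, OU_L0 V p &
    nrm (fun x => p.1 x - u x) <= e /\ nrm (fun x => p.2 x - v x) <= e) ->
  OU_L0 V (u, v).
Proof.
move=> Lu Lv H; apply/(op_closureP _ pre_L0_L2); split => // e e0.
have e20 : 0 < e / 2 by rewrite divr_gt0.
have [p Ap [p1 p2]] := H _ e20; have [Lp1 Lp2] := OU_L0_L2 Ap.
move: Ap => /(op_closureP _ pre_L0_L2)[_ _ /(_ _ e20)[a Aa [a1 a2]]].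
have [La1 La2] := pre_L0_L2 Aa; exists a => //=; split.
  by rewrite (le_trans (nrm_triangle La1 Lp1 Lu))// [leRHS]splitr lerD.
by rewrite (le_trans (nrm_triangle La2 Lp2 Lv))// [leRHS]splitr lerD.
Qed.

Let multiple_near (f g : E -> R[i]) e : L2 f -> L2 g -> nrm (fun x => f x - g x) <= e ->
  nrm (fun x => w x * f x - w x * g x) <= C * e.
Proof.
move=> Lf Lg fg; have [_] := L2_mul (ltW hC) mw wB (L2B Lf Lg).
rewrite (_ : (fun x => w x * (f x - g x)) = (fun x => w x * f x - w x * g x)).
  by move/le_trans; apply; rewrite ler_wpM2l// ltW.
by apply/funext => x; rewrite mulrBr.
Qed.

(** [pre_L] and [pre_L0] have the same domain, and [(u, v) |-> (u, v - w u)] carries the first graph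
    onto the second. As [w] is bounded, this map and its inverse are continuous on pairs of L^2
    functions, so it also carries one closure onto the other. *)
Lemma OU_L_perturbed :
  OU_L V = [set p | OU_L0 V (p.1, fun x => p.2 x - w x * p.1 x)].
Proof.
have C1 : 0 < 1 + C by rewrite ltr_wpDr// ltW.
(* An error [e / (1 + C)] in the graph norm becomes at most [e] after [w] times the error in [u], at
   most [C] times as large, is added. *)
have scale e : 0 < e -> e / (1 + C) <= e /\ e / (1 + C) + C * (e / (1 + C)) = e.
  move=> e0; split; last by field; rewrite gt_eqF.
  by rewrite ler_pdivrMr// ler_peMr ?lerDl ?(ltW hC) ?(ltW e0).
apply/seteqP; split => p /=.
  move=> /(op_closureP _ pre_L_L2)[L1 L2' H].
  apply/(op_closureP _ pre_L0_L2); split => //=; first by apply: L2B => //; exact: Lw.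
  move=> e e0; have [le1 le2] := scale e e0.
  have [[u v] [/= Du ->] [a1 a2]] := H _ (divr_gt0 e0 C1).
  exists (u, ou_expr u) => //=; split; first exact: le_trans a1 le1.
  have [[Lu _] _ Lo] := Du.
  rewrite [leLHS](_ : _ = nrm (fun x => (ouV_expr V u x - p.2 x)
      - (w x * u x - w x * p.1 x))); last first.
    congr nrm; apply/funext => x; rewrite /ouV_expr -/(w x).
    by move: (ou_expr u x) (w x * u x) (p.2 x) (w x * p.1 x) => ? ? ? ?; ring.
  rewrite (le_trans (nrmB (L2B Lo L2') (L2B (Lw Lu) (Lw L1))))// -le2 lerD//.
  exact: multiple_near.
move=> /(op_closureP _ pre_L0_L2)[/= L1 L2' H].
have Lp2 : L2 p.2.
  rewrite (_ : p.2 = fun x => (p.2 x - w x * p.1 x) + w x * p.1 x).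
    by apply: L2D => //; exact: Lw.
  by apply/funext => x; rewrite subrK.
apply/(op_closureP _ pre_L_L2); split => // e e0; have [le1 le2] := scale e e0.
have [[u v] [/= Du ve] [a1 a2]] := H _ (divr_gt0 e0 C1).
exists (u, ouV_expr V u) => //=; split; first exact: le_trans a1 le1.
have [[Lu _] _ Lo] := Du.
have Lou : L2 (ou_expr u) by have [] := pre_L0_L2 (conj Du (erefl (ou_expr u)) : pre_L0 V (u, ou_expr u)).
rewrite ve in a2.
rewrite [leLHS](_ : _ = nrm (fun x => (ou_expr u x - (p.2 x - w x * p.1 x))
    + (w x * u x - w x * p.1 x))); last first.
  congr nrm; apply/funext => x; rewrite /ouV_expr -/(w x).
  by move: (ou_expr u x) (w x * u x) (p.2 x) (w x * p.1 x) => ? ? ? ?; ring.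
rewrite (le_trans (nrmD (L2B Lou L2') (L2B (Lw Lu) (Lw L1))))// -le2 lerD//.
exact: multiple_near.
Qed.

(** Solvability of [(z - L_0) u = g] is taken from the resolvent set of [L_0]; the constants [K] and
    [1 / 2] of the Neumann series come from [closure_estimate]. *)
Lemma OU_L_resolvent (b omega : R) : 0 < b -> 0 < `|omega| ->
  4 * (C ^+ 2 * ((4 + 5 / b) / b + 1)) <= `|omega| ->
  resolvent_set (OU_L0 V : operator R d) ((d%:R + b) +i* omega) ->
  resolvent_set (OU_L V : operator R d) ((d%:R + b) +i* omega).
Proof.
move=> b0 w0 wl [_ solvable _]; rewrite OU_L_perturbed.
have est := closure_estimate b0 (sqr_ge0 C) mw wc w0 wl.
apply: (perturbed_resolvent (ltW hC) mw wB (sqrtr_ge0 _) OU_L0_L2 OU_L0_closed) => //.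
- by move=> p /OU_L0_smooth; exact: est.
- move=> p q /OU_L0_smooth Ap /OU_L0_smooth Aq.
  have := est _ (closure_smooth_graphB Ap Aq).
  rewrite (_ : shifted _ _ = fun x => shifted ((d%:R + b) +i* omega) p x
      - shifted ((d%:R + b) +i* omega) q x)//.
  by apply/funext => x; rewrite /shifted/=; ring.
Qed.

End potential.
End spectrum.

Theorem theorem1p2 (R : realType) (d : nat) (hd : (2 <= d)%N)
    (V V' : R -> R[i]) (C : R) (hC : 0 < C)
    (hV' : forall r : R, 0 <= r -> halfline_derivative V r (V' r))
    (hVbound : forall r : R, 0 <= r ->
       ComplexField.Normc.normc (V r) <= C * japanese r ^- 2)
    (hV'bound : forall r : R, 0 <= r ->
       ComplexField.Normc.normc (V' r) <= C * japanese r ^- 3)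
    (b : R) (hb : 0 < b) :
  exists M : R, forall z : R[i],
    (sigma' d V `&`
       [set z | exists omega : R, z = (d%:R + b) +i* omega]) z ->
    ComplexField.Normc.normc z <= M.
Proof.
pose K := 4 * (C ^+ 2 * ((4 + 5 / b) / b + 1)).
have K0 : 0 <= K.
  by rewrite !mulr_ge0 ?sqr_ge0 ?addr_ge0 ?divr_ge0 ?addr_ge0 ?divr_ge0// ltW.
(* If [|omega| <= K + 1], the triangle inequality gives this bound. Otherwise [omega] is nonzero and
   above the threshold [K], so [z], being in the resolvent set of [L_0], is in that of [L], against
   [zL]. *)
exists (d%:R + b + (K + 1)) => z [[zL zL0] [omega zE]].
have [omega_le|omega_gt] := leP `|omega| (K + 1).
  have -> : z = (d%:R + b)%:C + (0 +i* omega) by rewrite zE; simpc.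
  apply: le_trans (le_normcD _ _) _ => /=.
  rewrite expr0n/= addr0 add0r !sqrtr_sqr. by rewrite lerD// ger0_norm// addr_ge0// ltW.
case: zL; rewrite zE; apply: (OU_L_resolvent hC hV' hVbound hb).
- by rewrite (lt_trans _ omega_gt)// ltr_wpDl.
- by rewrite ltW// (lt_trans _ omega_gt)// ltrDl.
- by move: zL0; rewrite zE => /contrapT.
Qed.
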